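(* Let $(M,\eta)$ be a pre-symplectic manifold with kernel $K=\ker(\eta^\sharp)\subset TM$. Let $G\subset TM$ be a subbundle with $TM=K\oplus G$, and let $Z\in\Gamma(\wedge^2 G)$ be the bivector field determined by $Z^\sharp=-(\eta^\sharp|_G)^{-1}\colon G^*\to G$. Let $\beta$ be a $2$-form on $M$ which lies in $\mathcal{I}_Z$. Then the following statements are equivalent: (1) $\beta$ is a Maurer-Cartan element of the Koszul $L_\infty[1]$-algebra $(\Omega_{\mathrm{hor}}(M)[2],\lambda_1,\lambda_2,\lambda_3)$ of $(M,\eta)$, i.e. $\beta\in\Omega^2_{\mathrm{hor}}(M)$ and $$d(\beta[2])+\tfrac12\lambda_2(\beta[2]\odot\beta[2])+\tfrac16\lambda_3(\beta[2]\odot\beta[2]\odot\beta[2])=0.$$ (2) The $2$-form $\exp_\eta(\beta)=\eta+F(\beta)$ is a pre-symplectic structure of the same rank as $\eta$.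
   Context: A pre-symplectic form on a manifold $M$ is a closed $2$-form $\eta$ such that the bundle map $\eta^\sharp\colon TM\to T^*M$, $v\mapsto\eta(v,\cdot)$ has constant rank; this rank is the rank of $\eta$. For a $2$-form $\beta$ write $\beta^\sharp(v)=\iota_v\beta$; for a bivector field $Z$ write $Z^\sharp\colon T^*M\to TM$, $\xi\mapsto Z(\xi,\cdot)$. Here $G^*$ is identified with the annihilator $K^\circ\subset T^*M$, and $Z\in\Gamma(\wedge^2G)\subset\Gamma(\wedge^2TM)$, so that $Z^\sharp$ vanishes on $G^\circ\cong K^*$. $\Omega_{\mathrm{hor}}(M)=\{\beta\in\Omega(M): \beta \text{ vanishes when all arguments lie in } K\}$, i.e. the kernel of restriction $\Omega(M)\to\Gamma(\wedge K^* )$, equivalently the ideal generated by $\Gamma(K^\circ)$. $\mathcal{I}_Z\subset\wedge^2T^*M$ is the set of those $\beta$ for which $\mathrm{id}+Z^\sharp\beta^\sharp$ is invertible. $F\colon\mathcal{I}_Z\to\wedge^2T^*M$ is the fibrewise map determined by $(F(\beta))^\sharp=\beta^\sharp(\mathrm{id}+Z^\sharp\beta^\sharp)^{-1}$. Cartan calculus: $\iota_X\omega=\omega(X,\cdot,\dots,\cdot)$ for vector fields, $\iota_{X\wedge\tilde X}=\iota_X\circ\iota_{\tilde X}$; for a $k$-vector field $Y$, $\mathcal{L}_Y=\iota_Y\circ d-(-1)^k d\circ\iota_Y$; the Schouten-Nijenhuis bracket is normalized by $[\mathcal{L}_Y,\iota_{\tilde Y}]=\iota_{[Y,\tilde Y]}$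 (graded commutator of operators). For forms $\alpha_1,\dots,\alpha_n$ set $\alpha_i^\sharp(v)=\iota_v\alpha_i$ and $(\alpha_1^\sharp\wedge\dots\wedge\alpha_n^\sharp)(v_1\wedge\dots\wedge v_n)=\sum_{\sigma\in S_n}(-1)^{|\sigma|}\alpha_1^\sharp(v_{\sigma(1)})\wedge\dots\wedge\alpha_n^\sharp(v_{\sigma(n)})$. The graded vector space $\Omega(M)[2]$ has degree $k$ component $\Omega^{k+2}(M)$. The maps $\lambda_i$ on $\Omega(M)[2]$ are: $\lambda_1=d$ (de Rham differential), $$\lambda_2(\alpha[2]\odot\beta[2])=-\big(\mathcal{L}_Z(\alpha\wedge\beta)-\mathcal{L}_Z(\alpha)\wedge\beta-(-1)^{|\alpha|}\alpha\wedge\mathcal{L}_Z(\beta)\big)[2],$$ $$\lambda_3(\alpha[2]\odot\beta[2]\odot\gamma[2])=(-1)^{|\beta|+1}\big((\alpha^\sharp\wedge\beta^\sharp\wedge\gamma^\sharp)(\tfrac12[Z,Z])\big)[2].$$ They define an $L_\infty[1]$-algebra structure on $\Omega(M)[2]$ which restricts to $\Omega_{\mathrm{hor}}(M)[2]$; the restriction is the Koszul $L_\infty[1]$-algebra of $(M,\eta)$. *)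

(* Defs.v *)
From HB Require Import structures.
From mathcomp Require Import all_boot all_order all_algebra all_fingroup.
From mathcomp Require Import boolp classical_sets reals topology normedtype derive.
Import Order.TTheory GRing.Theory Num.Theory.
Import numFieldNormedType.Exports.

Set Implicit Arguments.
Unset Strict Implicit.
Unset Printing Implicit Defensive.

Local Open Scope classical_set_scope.
Local Open Scope ring_scope.

(** * Exterior algebra of R^n

    Vectors and covectors are both row vectors, with pairing
    <xi, v> = (v *m xi^T) 0 0.  A [multilin] is a function of finite sequences
    of arguments; its restriction to sequences of length k is its component of
    degree k, so that no degree appears in types.  Alternating forms are
    [multilin]s evaluated on vectors, multivectors are [multilin]s evaluated on
    covectors. *)

Definition multilin (R : realType) (n : nat) := seq 'rV[R]_n -> R.

Section Pointwise.
Context {R : realType} {n : nat}.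
Implicit Types (th : multilin R n) (s : seq 'rV[R]_n) (v xi : 'rV[R]_n).

(* e_i, and also the dual basis covector e^i *)
Definition evec (i : 'I_n) : 'rV[R]_n := delta_mx 0 i.

Definition alternating (k : nat) th : Prop :=
  [/\ forall s, size s != k -> th s = 0,
      forall s1 s2 (c : R) u v,
        th (s1 ++ (c *: u + v) :: s2) = c * th (s1 ++ u :: s2) + th (s1 ++ v :: s2)
    & forall s1 s2 s3 v, th (s1 ++ v :: s2 ++ v :: s3) = 0].

Definition contract_vec v th : multilin R n := fun s => th (v :: s).

(* The wedge product, with no factorial in its normalisation (so that
   e^1 /\ e^2 takes the value 1 on (e_1, e_2)), given by
   iota_v (a /\ b) = iota_v a /\ b + (-1)^|a| a /\ iota_v b.
   [fun t => (-1) ^+ size t * a t] is (-1)^|a| a, also for inhomogeneous a. *)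
Fixpoint wedge_rec (a b : multilin R n) s : R :=
  if s is v :: s' then
    wedge_rec (contract_vec v a) b s'
    + wedge_rec (fun t => (-1) ^+ size t * a t) (contract_vec v b) s'
  else a [::] * b [::].

Definition wedge_prod (a b : multilin R n) : multilin R n := wedge_rec a b.

Definition form1 : multilin R n := fun s => (size s == 0%N)%:R.

Definition wedge_seq (l : seq (multilin R n)) : multilin R n :=
  foldr wedge_prod form1 l.

Definition covector xi : multilin R n :=
  fun s => if s is [:: v] then (v *m xi^T) 0 0 else 0.

(* iota_Y with iota_(X /\ X') = iota_X o iota_X'.  A k-vector Y is
   \sum_(i_1 < ... < i_k) Y(e^i_1, ..., e^i_k) e_i_1 /\ ... /\ e_i_k, and
   (iota_e_i_1 o ... o iota_e_i_k) th = th(e_i_k, ..., e_i_1, ...).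
   [enum I] lists I increasingly. *)
Definition contract_mv (Y th : multilin R n) : multilin R n := fun s =>
  \sum_(I : {set 'I_n})
     Y (map evec (enum I)) * th (rev (map evec (enum I)) ++ s).

(* (alpha_1^# /\ ... /\ alpha_m^#)(T) for an m-vector T *)
Definition sharp_wedge (al : seq (multilin R n)) (T : multilin R n)
    : multilin R n := fun s =>
  \sum_(I : {set 'I_n} | #|I| == size al)
     T (map evec (enum I)) *
     \sum_(sg : 'S_(size al)) (-1) ^+ sg *
        wedge_seq [seq contract_vec (nth 0 (map evec (enum I)) (sg i))
                                (nth form1 al i) | i <- enum 'I_(size al)] s.

(* beta^# : v |-> iota_v beta is v |-> v *m sharp_mx beta, and
   Z^# : xi |-> Z(xi, .) is xi |-> xi *m sharp_mx Z; composites of such maps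
   are therefore matrix products in the opposite order. *)
Definition sharp_mx th : 'M[R]_n := \matrix_(i, j) th [:: evec i; evec j].

Definition form_of_mx (A : 'M[R]_n) : multilin R n :=
  fun s => if s is [:: u; v] then (u *m A *m v^T) 0 0 else 0.

(* id + Z^# beta^# is invertible *)
Definition in_I (Z be : multilin R n) : bool :=
  1%:M + sharp_mx be *m sharp_mx Z \in unitmx.

(* F(beta)^# = beta^# (id + Z^# beta^#)^-1 *)
Definition Fmap (Z be : multilin R n) : multilin R n :=
  form_of_mx (invmx (1%:M + sharp_mx be *m sharp_mx Z) *m sharp_mx be).

End Pointwise.

(** * Cartan calculus and the Koszul brackets in a coordinate chart *)

Definition localfield (R : realType) (n : nat) := 'rV[R]_n -> multilin R n.

Section Local.
Context {R : realType} {n : nat}.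
Implicit Types (w a b c Y Z : localfield R n).

(* De Rham differential: for constant vector fields v_0, ..., v_k,
   dw(v_0, ..., v_k) = \sum_i (-1)^i D_{v_i} (w(v_0, .., v_i omitted, .., v_k)) *)
Definition dext w : localfield R n := fun x s =>
  \sum_(i < size s) (-1) ^+ i *
     'D_(nth 0 s i) (fun y => w y (take i s ++ drop i.+1 s)) x.

Definition lwedge a b : localfield R n := fun x => wedge_prod (a x) (b x).

Definition lcontract Y w : localfield R n := fun x => contract_mv (Y x) (w x).

(* L_Y = iota_Y d - (-1)^k d iota_Y for a k-vector field Y *)
Definition lie (k : nat) Y w : localfield R n := fun x s =>
  lcontract Y (dext w) x s - (-1) ^+ k * dext (lcontract Y w) x s.

(* [L_Y, iota_Y'] w for a k-vector field Y and an l-vector field Y'; L_Y has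
   degree 1 - k and iota_Y' has degree - l. *)
Definition lie_contract_comm (k l : nat) Y Y' w : localfield R n := fun x s =>
  lie k Y (lcontract Y' w) x s - (-1) ^+ (k.-1 * l) * lcontract Y' (lie k Y w) x s.

(* Schouten-Nijenhuis bracket, normalised by [L_Y, iota_Y'] = iota_[Y, Y'].
   With the convention for iota above,
   iota_T (xi_m /\ ... /\ xi_1) = T(xi_1, ..., xi_m) for an m-vector T, so
   [Y, Y'](xi_1, ..., xi_m) is the value of [L_Y, iota_Y'] on the constant form
   xi_m /\ ... /\ xi_1. *)
Definition schouten (k l : nat) Y Y' : localfield R n := fun x s =>
  lie_contract_comm k l Y Y' (fun=> wedge_seq (map covector (rev s))) x [::].

(* The brackets on Omega(M)[2]; the shift is left implicit.  The degree of the
   form on which a sign depends is passed explicitly: [p] is |a| in [lam2],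
   [q] is |b| in [lam3]. *)
Definition lam1 w : localfield R n := dext w.

Definition lam2 Z (p : nat) a b : localfield R n := fun x s =>
  - (lie 2 Z (lwedge a b) x s - lwedge (lie 2 Z a) b x s
     - (-1) ^+ p * lwedge a (lie 2 Z b) x s).

Definition lam3 Z (q : nat) a b c : localfield R n := fun x s =>
  (-1) ^+ q.+1 *
  sharp_wedge [:: a x; b x; c x] (fun t => 2^-1 * schouten 2 2 Z Z x t) s.

End Local.

(** * Smooth manifolds *)

Section Smooth.
Context {R : realType} {V W : normedModType R}.

Fixpoint differentiable_upto (k : nat) (U : set V) (f : V -> W) : Prop :=
  if k is k'.+1 then
    (forall x, U x -> differentiable f x) /\
    (forall v, differentiable_upto k' U ('D_v f))
  else True.

(* C^oo on the open set U *)
Definition smooth_on (U : set V) (f : V -> W) : Prop :=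
  forall k, differentiable_upto k U f.

End Smooth.

Record manifold (R : realType) (n : nat) := Manifold {
  carrier : topologicalType;
  manifold_hausdorff : hausdorff_space carrier;
  manifold_second_countable : @second_countable carrier;
  chart_index : Type;
  chart_dom : chart_index -> set carrier;
  chart : chart_index -> carrier -> 'rV[R]_n;
  chart_inv : chart_index -> 'rV[R]_n -> carrier;
  chart_cover : forall p, exists a, chart_dom a p;
  chart_dom_open : forall a, open (chart_dom a);
  chart_img_open : forall a, open (chart a @` chart_dom a);
  chartK : forall a p, chart_dom a p -> chart_inv a (chart a p) = p;
  chart_continuous : forall a p, chart_dom a p -> {for p, continuous (chart a)};
  chart_inv_continuous : forall a x, (chart a @` chart_dom a) x ->
    {for x, continuous (chart_inv a)};
  transition_smooth : forall a b,
    smooth_on (chart a @` (chart_dom a `&` chart_dom b))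
              (fun x => chart b (chart_inv a x))
}.

(** * Tensor fields on a manifold

    A tensor field is given by its expression in every chart a, at the points of
    [chart_img a]; its values elsewhere are irrelevant. *)

Section Fields.
Context {R : realType} {n : nat} (M : manifold R n).

Definition chart_img (a : chart_index M) : set 'rV[R]_n :=
  chart a @` chart_dom a.

Definition overlap (a b : chart_index M) : set 'rV[R]_n :=
  chart a @` (chart_dom a `&` chart_dom b).

Definition transition (a b : chart_index M) (x : 'rV[R]_n) : 'rV[R]_n :=
  chart b (chart_inv a x).

Definition tensor_field := chart_index M -> localfield R n.

Definition smooth_alternating (k : nat) (w : tensor_field) : Prop :=
  (forall a x, chart_img a x -> alternating k (w a x)) /\
  (forall a s, smooth_on (chart_img a) (fun x => w a x s)).

(* w \in Omega^k(M); vectors are pushed forward by v |-> v *m J *)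
Definition diff_form (k : nat) (w : tensor_field) : Prop :=
  smooth_alternating k w /\
  forall a b x, overlap a b x -> forall s,
    w a x s = w b (transition a b x) [seq v *m 'J (transition a b) x | v <- s].

(* Y \in Gamma(/\^k TM); covectors are pulled back by xi |-> xi *m J^T *)
Definition multivector_field (k : nat) (Y : tensor_field) : Prop :=
  smooth_alternating k Y /\
  forall a b x, overlap a b x -> forall s,
    Y b (transition a b x) s =
    Y a x [seq xi *m ('J (transition a b) x)^T | xi <- s].

Definition field_eq0 (w : tensor_field) : Prop :=
  forall a x, chart_img a x -> forall s, w a x s = 0.

(* A family of subspaces of the tangent spaces, the fibre in the chart a at x
   being the row space of the matrix. *)
Definition tangent_distribution := chart_index M -> 'rV[R]_n -> 'M[R]_n.

Definition subbundle (G : tangent_distribution) : Prop :=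
  (exists k : nat, forall a x, chart_img a x ->
     exists (U : set 'rV[R]_n) (S : 'rV[R]_n -> 'M[R]_(k, n)),
       [/\ open U, U x, U `<=` chart_img a, smooth_on U S
         & forall y, U y -> row_free (S y) /\ (S y == G a y)%MS]) /\
  forall a b x, overlap a b x ->
    (G a x *m 'J (transition a b) x == G b (transition a b x))%MS.

(* ker(eta^#) *)
Definition ker_sharp (eta : tensor_field) : tangent_distribution :=
  fun a x => kermx (sharp_mx (eta a x)).

(* TM = K (+) G *)
Definition complementary (K G : tangent_distribution) : Prop :=
  forall a x, chart_img a x ->
    (K a x + G a x == 1%:M)%MS /\ (K a x :&: G a x)%MS = 0.

(* pre-symplectic form of rank r *)
Definition presymplectic (r : nat) (eta : tensor_field) : Prop :=
  [/\ diff_form 2 eta,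
      field_eq0 (fun a => dext (eta a))
    & forall a x, chart_img a x -> \rank (sharp_mx (eta a x)) = r].

(* Z \in Gamma(/\^2 G): Z^# vanishes on the annihilator of G, and hence, by
   antisymmetry, has values in G. *)
Definition section_wedge2 (G : tangent_distribution) (Z : tensor_field) : Prop :=
  multivector_field 2 Z /\
  forall a x, chart_img a x -> forall xi : 'rV[R]_n,
    G a x *m xi^T = 0 -> xi *m sharp_mx (Z a x) = 0.

(* Z^# = - (eta^#|_G)^-1 on G^*, identified with the annihilator of
   K = ker eta^#; eta^# maps G isomorphically onto this annihilator. *)
Definition minus_inverse_on (G : tangent_distribution) (eta Z : tensor_field) : Prop :=
  forall a x, chart_img a x -> forall v : 'rV[R]_n, (v <= G a x)%MS ->
    v *m sharp_mx (eta a x) *m sharp_mx (Z a x) = - v.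

(* be is a section of I_Z *)
Definition section_I (Z be : tensor_field) : Prop :=
  forall a x, chart_img a x -> in_I (Z a x) (be a x).

Definition horizontal (K : tangent_distribution) (w : tensor_field) : Prop :=
  forall a x, chart_img a x -> forall s,
    (forall v, v \in s -> (v <= K a x)%MS) -> w a x s = 0.

(* Maurer-Cartan elements of (Omega_hor(M)[2], lam1, lam2, lam3); they have
   degree 0 in Omega(M)[2], i.e. they are 2-forms. *)
Definition maurer_cartan (K : tangent_distribution) (Z be : tensor_field) : Prop :=
  [/\ diff_form 2 be, horizontal K be
    & field_eq0 (fun a x s =>
        lam1 (be a) x s
        + 2^-1 * lam2 (Z a) 2 (be a) (be a) x s
        + 6^-1 * lam3 (Z a) 2 (be a) (be a) (be a) x s)].

Definition exp_eta (eta Z be : tensor_field) : tensor_field :=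
  fun a x s => eta a x s + Fmap (Z a x) (be a x) s.

End Fields.

(* Main.v *)
(** Fix a chart, let [E], [B], [Z] be the matrices of eta, beta and the bivector
    field, and put [N = 1 + BZ], so that [F = N^-1 B].

    Rank: [P = 1 + EZ] is the projection onto [K = ker E] along [G], and
    [N (E + F) = E + B P^T].  Relative to [TM = G + K] this matrix is block upper
    triangular with diagonal blocks [E_G] (invertible) and [B_KK], so its rank is
    that of [E] iff [B_KK = 0], i.e. iff beta is horizontal.

    Closedness: differentiating [N F = B] gives [N dF N^T = dB - B dZ B].  Hence
    the value of [dF] on [u_1 N, u_2 N, u_3 N] is the cyclic sum of
    [u_2 (dB - B dZ B) u_3^T], derivatives being taken in the direction [u_1 N].
    Its terms of degree 0, 1, 2 in [Z] are [lam1], [lam2 / 2] and [lam3 / 6], so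
    that the Maurer-Cartan expression is the pullback of [dF] by the invertible
    map [N]. *)

Require Import Defs.
From mathcomp Require Import all_boot all_order all_algebra all_fingroup.
From mathcomp Require Import ring.
From mathcomp Require Import boolp classical_sets functions reals topology.
From mathcomp Require Import normedtype landau derive.
Import Order.TTheory GRing.Theory Num.Theory.
Import numFieldNormedType.Exports.

Set Implicit Arguments.
Unset Strict Implicit.
Unset Printing Implicit Defensive.

Local Open Scope classical_set_scope.
Local Open Scope ring_scope.

(** * Smooth functions *)

Section SmoothFunctions.
Context {R : realType} {V : normedModType R}.
Implicit Types (U : set V) (f g : V -> R).

(** The zero map serves as differential, since the remainder then vanishes near [x]. This lets
    differentiability pass between functions that agree only near a point. *)
Lemma near0_differentiable f x : (\near x, f x = 0) -> differentiable f x.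
Proof.
move=> f0.
have fo : f \o shift x = cst (f x) + \0 +o_ 0 id.
  apply/eqaddoP => e e0; rewrite (nbhs_singleton f0).
  have : \forall y \near 0, f (y + x) = 0 by move: f0; rewrite (near_shift 0) subr0.
  apply: filterS => y /= fy.
  by rewrite !fctE /= fy addr0 subr0 normr0 mulr_ge0 // ltW.
have d0 : 'd f x = \0 :> (V -> R).
  by apply: diff_unique => //; exact: cst_continuous.
by apply/diff_locallyP; rewrite d0; split => //; exact: cst_continuous.
Qed.

Lemma near_eq_differentiable f g x :
  (\near x, f x = g x) -> differentiable f x -> differentiable g x.
Proof.
move=> fg df; have -> : g = f + (g - f) by rewrite addrC subrK.
apply: differentiableD => //; apply: near0_differentiable.
by apply: filterS fg => y /= fgy; rewrite !fctE fgy subrr.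
Qed.

Lemma differentiable_upto_eq k U f g : open U -> {in U, f =1 g} ->
  differentiable_upto k U f -> differentiable_upto k U g.
Proof.
move=> oU; elim: k f g => [//|k IH] f g fg [df Df].
have nfg x : U x -> \near x, f x = g x.
  move=> Ux; apply: filterS (open_nbhs_nbhs (conj oU Ux)) => y Uy.
  by apply: fg; rewrite inE.
split=> [x Ux|v]; first by apply: (near_eq_differentiable (nfg _ Ux)); apply: df.
apply: IH (Df v) => x; rewrite inE => Ux.
exact/near_eq_derive/nfg.
Qed.

Lemma smooth_on_eq U f g : open U -> {in U, f =1 g} ->
  smooth_on U f -> smooth_on U g.
Proof. by move=> oU fg sf k; exact: differentiable_upto_eq (sf k). Qed.

Lemma differentiable_uptoW k U f :
  differentiable_upto k.+1 U f -> differentiable_upto k U f.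
Proof.
elim: k f => [//|k IH] f [df Df]; split=> // v.
exact/IH/Df.
Qed.

Lemma differentiable_upto_cst k U (c : R) : differentiable_upto k U (cst c).
Proof.
elim: k c => [//|k IH] c; split=> [x _|v]; first exact: differentiable_cst.
by rewrite (_ : 'D_v (cst c) = cst 0) //; apply/funext => x; exact: derive_cst.
Qed.

Lemma differentiable_uptoD k U f g : open U ->
  differentiable_upto k U f -> differentiable_upto k U g ->
  differentiable_upto k U (fun x => f x + g x).
Proof.
move=> oU; elim: k f g => [//|k IH] f g [df Df] [dg Dg]; split=> [x Ux|v].
  by apply: differentiableD; [exact: df|exact: dg].
apply: (@differentiable_upto_eq _ _ (fun x => 'D_v f x + 'D_v g x))
  (IH _ _ (Df v) (Dg v)) => //.
move=> x; rewrite inE => Ux; rewrite -deriveD //; apply: diff_derivable;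
  [exact: df|exact: dg].
Qed.

Lemma differentiable_uptoM k U f g : open U ->
  differentiable_upto k U f -> differentiable_upto k U g ->
  differentiable_upto k U (fun x => f x * g x).
Proof.
move=> oU; elim: k f g => [//|k IH] f g sf sg.
have [[df Df] [dg Dg]] := (sf, sg); split=> [x Ux|v].
  by apply: differentiableM; [exact: df|exact: dg].
apply: (@differentiable_upto_eq _ _ (fun x => f x * 'D_v g x + g x * 'D_v f x)) => //.
  move=> x; rewrite inE => Ux; rewrite -deriveM //; apply: diff_derivable;
  [exact: df|exact: dg].
(* The product rule leaves one factor undifferentiated; its order is lowered from [k.+1] to [k] to
   fit the induction hypothesis. *)
apply: differentiable_uptoD => //; apply: IH;
  by (exact: Dg || exact: Df || exact: differentiable_uptoW).
Qed.

(** The derivative -f^-2 f' contains 1/f again, but only to order [k], which the induction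
    supplies. *)
Lemma differentiable_uptoV k U f : open U -> (forall x, U x -> f x != 0) ->
  differentiable_upto k U f -> differentiable_upto k U (fun x => (f x)^-1).
Proof.
move=> oU f0; elim: k => [//|k IH] sf; have [df Df] := sf; split=> [x Ux|v].
  by apply: differentiableV; [exact: df|exact: f0].
have sV := IH (differentiable_uptoW sf).
apply: (@differentiable_upto_eq _ _ (fun x => -1 * ((f x)^-1 * (f x)^-1 * 'D_v f x)))
  => //.
  move=> x; rewrite inE => Ux; rewrite deriveV; [|exact: f0|exact/diff_derivable/df].
  by rewrite mulN1r scaleNr expr2 invfM.
apply: differentiable_uptoM => //; first exact: differentiable_upto_cst.
by apply: differentiable_uptoM; [by []|exact: differentiable_uptoM|exact: Df].
Qed.

Lemma smooth_on_cst U (c : R) : smooth_on U (cst c).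
Proof. by move=> k; exact: differentiable_upto_cst. Qed.

Lemma smooth_onD U f g : open U -> smooth_on U f -> smooth_on U g ->
  smooth_on U (fun x => f x + g x).
Proof. by move=> oU sf sg k; exact: differentiable_uptoD. Qed.

Lemma smooth_onM U f g : open U -> smooth_on U f -> smooth_on U g ->
  smooth_on U (fun x => f x * g x).
Proof. by move=> oU sf sg k; exact: differentiable_uptoM. Qed.

Lemma smooth_onV U f : open U -> (forall x, U x -> f x != 0) ->
  smooth_on U f -> smooth_on U (fun x => (f x)^-1).
Proof. by move=> oU f0 sf k; exact: differentiable_uptoV. Qed.

Lemma smooth_on_sum U I (r : seq I) (P : pred I) (F : I -> V -> R) : open U ->
  (forall i, smooth_on U (F i)) ->
  smooth_on U (fun x => \sum_(i <- r | P i) F i x).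
Proof.
move=> oU sF; elim: r => [|i r IH].
  by under [X in smooth_on _ X]eq_fun do rewrite big_nil; exact: smooth_on_cst.
under [X in smooth_on _ X]eq_fun do rewrite big_cons.
by case: (P i) => //; exact: smooth_onD.
Qed.

Lemma smooth_on_prod U I (r : seq I) (P : pred I) (F : I -> V -> R) : open U ->
  (forall i, smooth_on U (F i)) ->
  smooth_on U (fun x => \prod_(i <- r | P i) F i x).
Proof.
move=> oU sF; elim: r => [|i r IH].
  by under [X in smooth_on _ X]eq_fun do rewrite big_nil; exact: smooth_on_cst.
under [X in smooth_on _ X]eq_fun do rewrite big_cons.
by case: (P i) => //; exact: smooth_onM.
Qed.

Lemma smooth_on_differentiable U f x : smooth_on U f -> U x -> differentiable f x.
Proof. by move=> /(_ 1%N)[df _] Ux; exact: df. Qed.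

Lemma smooth_on_derivable U f x v : smooth_on U f -> U x -> derivable f x v.
Proof. by move=> sf Ux; apply: diff_derivable; exact: smooth_on_differentiable sf Ux. Qed.

Definition smooth_mx_on (m p : nat) U (A : V -> 'M[R]_(m, p)) :=
  forall i j, smooth_on U (fun x => A x i j).

Lemma smooth_mx_onM (m p q : nat) U (A : V -> 'M_(m, p)) (B : V -> 'M_(p, q)) :
  open U -> smooth_mx_on U A -> smooth_mx_on U B ->
  smooth_mx_on U (fun x => A x *m B x).
Proof.
move=> oU sA sB i j; under [X in smooth_on _ X]eq_fun do rewrite mxE.
by apply: smooth_on_sum => // k; exact: smooth_onM.
Qed.

Lemma smooth_mx_on_det (m : nat) U (A : V -> 'M_m) :
  open U -> smooth_mx_on U A -> smooth_on U (fun x => \det (A x)).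
Proof.
move=> oU sA; rewrite /determinant; apply: smooth_on_sum => // s.
apply: smooth_onM => //; first exact: smooth_on_cst.
exact: smooth_on_prod.
Qed.

(** Cramer's rule expresses the inverse through determinants. The formula is used on [U] only,
    because [invmx] returns its argument on singular matrices. *)
Lemma smooth_mx_on_inv (m : nat) U (A : V -> 'M_m) : open U ->
  (forall x, U x -> A x \in unitmx) -> smooth_mx_on U A ->
  smooth_mx_on U (fun x => invmx (A x)).
Proof.
move=> oU uA sA i j.
apply: (@smooth_on_eq _ (fun x => (\det (A x))^-1 * ((-1) ^+ (j + i) *
          \det (row' j (col' i (A x)))))) => //.
  by move=> x; rewrite inE => /uA uAx; rewrite /invmx uAx !mxE.
apply: smooth_onM => //.
  apply: smooth_onV => //; last exact: smooth_mx_on_det.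
  by move=> x /uA; rewrite unitmxE unitfE.
apply: smooth_onM => //; first exact: smooth_on_cst.
apply: smooth_mx_on_det => // k l.
by under [X in smooth_on _ X]eq_fun do rewrite !mxE; exact: sA.
Qed.

End SmoothFunctions.

(** * Pointwise linear algebra *)

Section Algebra.
Context {R : realType} {n : nat}.
Implicit Types (th a b : multilin R n) (s : seq 'rV[R]_n) (u v w : 'rV[R]_n).
Implicit Types (A B E G K Z : 'M[R]_n).

Lemma alternating_sum k th s1 s2 m (c : 'I_m -> R) (f : 'I_m -> 'rV[R]_n) :
  alternating k th ->
  th (s1 ++ (\sum_i c i *: f i) :: s2) = \sum_i c i * th (s1 ++ f i :: s2).
Proof.
(* Linearity with c = 1 and u = v = 0 gives th 0 = th 0 + th 0. *)
case=> _ lin _; have th0 : th (s1 ++ 0 :: s2) = 0.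
  have := lin s1 s2 1 0 0; rewrite scaler0 addr0 mul1r => /esym/eqP.
  by rewrite -subr_eq0 addrK => /eqP.
by elim/big_rec2: _ => [//|i x y _ IH]; rewrite lin IH.
Qed.

Lemma alternating2_mx th u v : alternating 2 th ->
  th [:: u; v] = (u *m sharp_mx th *m v^T) 0 0.
Proof.
move=> ath; have -> : u = \sum_i u 0 i *: evec i by exact: row_sum_delta.
rewrite (alternating_sum [::] _ _ _ ath) /= !mulmx_suml summxE.
apply: eq_bigr => i _; rewrite -!scalemxAl mxE; congr (_ * _).
rewrite [X in th [:: _; X]]row_sum_delta (alternating_sum [:: evec i] [::] _ _ ath) /=.
rewrite mxE; apply: eq_bigr => j _; rewrite -rowE !mxE mulrC; congr (_ * _).
Qed.

(** Polarisation: expand the vanishing value on (u + v, u + v). The factor [1 *:] gives the sum the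
    shape of the linearity clause. *)
Lemma alternating2C th u v : alternating 2 th -> th [:: v; u] = - th [:: u; v].
Proof.
move=> [_ lin alt]; have H := alt [::] [::] [::] (1 *: u + v).
have := H; rewrite /= (lin [::]) /= (lin [:: u] [::]) (lin [:: v] [::]) /=.
rewrite (alt [::] [::] [::] u) (alt [::] [::] [::] v) !mul1r add0r addr0.
by move/eqP; rewrite addr_eq0 => /eqP ->; rewrite opprK.
Qed.

Lemma sharp_mx_tr th : alternating 2 th -> (sharp_mx th)^T = - sharp_mx th.
Proof. by move=> ath; apply/matrixP => i j; rewrite !mxE alternating2C. Qed.

Lemma form_of_mxK A : sharp_mx (form_of_mx A) = A.
Proof. by apply/matrixP => i j; rewrite mxE /= /evec -rowE trmx_delta -colE !mxE. Qed.

Lemma alternating_form_of_mx A : A^T = - A -> alternating 2 (form_of_mx A).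
Proof.
move=> skewA; split.
- by case=> [|? [|? [|]]].
- case=> [|? [|? [|? ?]]] [|? [|? ?]] c u v //=; rewrite ?mulr0 ?addr0 //.
  + by rewrite !mulmxDl -!scalemxAl !mxE.
  + by rewrite linearD linearZ /= mulmxDr -scalemxAr !mxE.
(* The 1 x 1 matrix [x] equals its transpose, and skewness of [A] makes it change sign under
   transposition, so 2x = 0. *)
- case=> [|? [|? [|? ?]]] [|? [|? ?]] [|? ?] v //=; set x := _ *m _.
  have : x^T = - x by rewrite /x !trmx_mul trmxK skewA mulNmx mulmxN mulmxA.
  move/matrixP/(_ 0 0); rewrite !mxE => /eqP; rewrite -addr_eq0 -mulr2n mulrn_eq0.
  by case/orP => // /eqP.
Qed.

Lemma alternatingD k a b : alternating k a -> alternating k b ->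
  alternating k (fun s => a s + b s).
Proof.
move=> [sa la aa] [sb lb ab]; split=> [s ks|s1 s2 c u v|s1 s2 s3 v].
- by rewrite sa // sb // addr0.
- by rewrite la lb; ring.
- by rewrite aa ab addr0.
Qed.

Lemma mul_N_tr B Z : B^T = - B -> Z^T = - Z ->
  (1%:M + B *m Z)^T = 1%:M + Z *m B.
Proof. by move=> sB sZ; rewrite linearD /= trmx1 trmx_mul sB sZ mulNmx mulmxN opprK. Qed.

(** The push-through identity B(1 + ZB) = (1 + BZ)B. For skew [B] and [Z], with N = 1 + BZ and F =
    N^-1 B, it says F N^T = B. *)
Lemma mul_F_tr B Z : 1%:M + B *m Z \in unitmx ->
  invmx (1%:M + B *m Z) *m B *m (1%:M + Z *m B) = B.
Proof.
move=> uN; rewrite -mulmxA.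
have -> : B *m (1%:M + Z *m B) = (1%:M + B *m Z) *m B.
  by rewrite mulmxDl mulmxDr mul1mx mulmx1 mulmxA.
by rewrite mulKmx.
Qed.

(** Transposition turns N^-1 B into -B(1 + ZB)^-1, which equals -N^-1 B by the push-through
    identity. *)
Lemma F_skew B Z : B^T = - B -> Z^T = - Z -> 1%:M + B *m Z \in unitmx ->
  (invmx (1%:M + B *m Z) *m B)^T = - (invmx (1%:M + B *m Z) *m B).
Proof.
move=> sB sZ uN; rewrite trmx_mul trmx_inv mul_N_tr // sB mulNmx; congr (- _).
have uT : 1%:M + Z *m B \in unitmx by rewrite -mul_N_tr // unitmx_tr.
by apply: (canLR (mulmxK uT)); rewrite mul_F_tr.
Qed.

(** Tensoriality of F: with [J] the Jacobian of a change of charts, N_a J = J N_b, so F transforms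
    as a 2-form. *)
Lemma F_congr (J Ba Bb Za Zb : 'M[R]_n) :
  Ba = J *m Bb *m J^T -> Zb = J^T *m Za *m J ->
  1%:M + Ba *m Za \in unitmx -> 1%:M + Bb *m Zb \in unitmx ->
  invmx (1%:M + Ba *m Za) *m Ba = J *m (invmx (1%:M + Bb *m Zb) *m Bb) *m J^T.
Proof.
move=> eB eZ uNa uNb; apply: (canLR (mulKmx uNa)); rewrite !mulmxA.
have -> : (1%:M + Ba *m Za) *m J = J *m (1%:M + Bb *m Zb).
  by rewrite mulmxDl mulmxDr mul1mx mulmx1 eB eZ !mulmxA.
by rewrite mulmxK.
Qed.

(** With P = 1 + EZ, Q = 1 + ZE and M = E + BQ, one has PE = 0, QZ = 0 and N(E + F) = M, so the rank
    of [M] decides. *)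
Lemma rank_exp E B Z : E *m Z *m E = - E -> Z *m E *m Z = - Z ->
  1%:M + B *m Z \in unitmx ->
  \rank (E + invmx (1%:M + B *m Z) *m B)%R = \rank E <->
  (1%:M + E *m Z) *m B *m (1%:M + Z *m E) = 0.
Proof.
move=> EZE ZEZ uN; set N := 1%:M + B *m Z in uN *.
have PE : (1%:M + E *m Z) *m E = 0 by rewrite mulmxDl mul1mx EZE subrr.
have PZ : (1%:M + Z *m E) *m Z = 0 by rewrite mulmxDl mul1mx ZEZ subrr.
set M := E + B *m (1%:M + Z *m E).
have -> : \rank (E + invmx N *m B)%R = \rank M.
  (* Transposing moves the invertible left factor [N] to the right, where [mxrankMfree] cancels
     it. *)
  rewrite -mxrank_tr -[RHS]mxrank_tr.
  have -> : M = N *m (E + invmx N *m B).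
    by rewrite mulmxDr mulKVmx // /M /N mulmxDl mulmxDr mul1mx mulmx1 mulmxA addrAC addrA.
  by rewrite trmx_mul mxrankMfree // row_free_unit unitmx_tr.
split=> [rM|PBP].
  (* E = -M(ZE) puts the column space of [E] inside that of [M]. Equal ranks make the two coincide,
     so M = E X^T is killed by P, and PM = PBQ. *)
  have sEM : (E^T <= M^T)%MS.
    have -> : E = M *m (- (Z *m E)).
      rewrite /M mulmxN mulmxDl -mulmxA [(1%:M + _) *m _]mulmxA PZ mul0mx mulmx0 addr0.
      by rewrite mulmxA EZE opprK.
    by rewrite trmx_mul submxMl.
  have [_] := mxrank_leqif_sup sEM.
  rewrite !mxrank_tr rM eqxx => /esym/submxP[X EX].
  have MX : M = E *m X^T by rewrite -[LHS]trmxK EX trmx_mul trmxK.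
  have : (1%:M + E *m Z) *m M = 0 by rewrite MX mulmxA PE mul0mx.
  by rewrite {1}/M (mulmxDr _ E) PE add0r mulmxA.
(* If PBQ = 0 then M = E(1 - U). Since QZ = 0, U squares to zero and 1 - U has inverse 1 + U. *)
set U := Z *m B *m (1%:M + Z *m E).
have UU : U *m U = 0.
  by rewrite /U -mulmxA 2!(mulmxA (1%:M + _)) PZ !mul0mx mulmx0.
have -> : M = E *m (1%:M - U).
  rewrite /M mulmxBr mulmx1; congr (_ + _).
  move/eqP: PBP; rewrite -mulmxA mulmxDl mul1mx addr_eq0 => /eqP ->.
  by rewrite /U !mulmxA.
rewrite mxrankMfree // row_free_unit.
have : (1%:M - U) *m (1%:M + U) = 1%:M.
  by rewrite mulmxDr mulmx1 mulmxBl mul1mx UU subr0 subrK.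
by case/mulmx1_unit.
Qed.

(** Up to sign, [Z] is a generalised inverse of [E]. The first identity is checked on K, which [E]
    kills, and on G, where v E Z = -v. The second holds because the rows of 1 + ZE, seen as
    covectors, annihilate G. *)
Lemma complement_inverse E K Z G : K *m E = 0 ->
  E^T = - E -> Z^T = - Z -> (K + G == 1%:M)%MS ->
  (forall xi : 'rV_n, G *m xi^T = 0 -> xi *m Z = 0) ->
  (forall v, (v <= G)%MS -> v *m E *m Z = - v) ->
  E *m Z *m E = - E /\ Z *m E *m Z = - Z.
Proof.
move=> KE sE sZ /andP[_ /sub_addsmxP[[X Y] /= KG]] ZG EZ.
have GEZ : G *m E *m Z = - G.
  by apply/row_matrixP => i; rewrite !row_mul EZ ?row_sub // linearN.
split; apply/eqP; rewrite -addr_eq0.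
  have XK : X *m K *m E = 0 by rewrite -mulmxA KE mulmx0.
  have YG : Y *m G *m E *m Z = - (Y *m G) by rewrite -!mulmxA (mulmxA G) GEZ mulmxN.
  rewrite -[E *m Z *m E + E]mul1mx KG mulmxDl !(mulmxDr _ _ E) !mulmxA. rewrite XK YG.
  by rewrite !mul0mx mulNmx addNr !addr0.
apply/eqP/row_matrixP => i; rewrite row0.
have -> : Z *m E *m Z + Z = (1%:M + Z *m E) *m Z by rewrite mulmxDl mul1mx addrC.
rewrite row_mul; apply: ZG.
rewrite tr_row; have -> : (1%:M + Z *m E)^T = 1%:M + E *m Z.
  by rewrite linearD /= trmx1 trmx_mul sE sZ mulNmx mulmxN opprK.
by rewrite colE mulmxA mulmxDr mulmx1 mulmxA GEZ subrr mul0mx.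
Qed.

End Algebra.

(** * Sums over two- and three-element sets of indices *)

Section SumsOverSubsets.
Context {V : zmodType} {n : nat}.
Implicit Types (h : seq 'I_n -> V) (I : {set 'I_n}) (i j k : 'I_n).

Let ltI := relpre (@nat_of_ord n) ltn.

Lemma sorted_enum_set I : sorted ltI (enum I).
Proof.
have ltI_tr : transitive ltI by move=> ? ? ?; exact: ltn_trans.
have -> : enum I = [seq i <- enum 'I_n | i \in I].
  by rewrite /enum_mem -filter_predI; apply: eq_filter => i; rewrite /= andbT.
apply: (sorted_filter ltI_tr).
by rewrite -sorted_map val_enum_ord iota_ltn_sorted.
Qed.

Lemma enum_sorted_set (s : seq 'I_n) : sorted ltI s -> enum [set i in s] = s.
Proof.
move=> ss; apply: (@irr_sorted_eq _ ltI) => //.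
- by move=> ? ? ?; exact: ltn_trans.
- by move=> ?; exact: ltnn.
- exact: sorted_enum_set.
- by move=> i; rewrite mem_enum inE.
Qed.

(** Two-element sets correspond to increasing pairs; [f] reads the pair off the enumeration and is
    the partial inverse used for reindexing. *)
Lemma sum_card2 h : \sum_(I : {set 'I_n} | #|I| == 2) h (enum I) =
  \sum_(p : 'I_n * 'I_n | (p.1 < p.2)%N) h [:: p.1; p.2].
Proof.
pose f I := if enum I is [:: i; j] then Some (i, j) else None.
rewrite (reindex_omap (fun p : 'I_n * 'I_n => [set i in [:: p.1; p.2]]) f) /=.
  apply: eq_big => [[i j]|[i j] /andP[_]] /=; rewrite /f; last first.
    by case: (enum _) => [|? [|? [|? ?]]] //= /eqP[-> ->].
  apply/andP/idP => [[_]|ij]; last first.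
    rewrite enum_sorted_set /= ?eqxx ?cardE ?enum_sorted_set //= /ltI /= ij //.
  move: (sorted_enum_set [set i0 in [:: i; j]]).
  by case: (enum _) => [|? [|? [|? ?]]] //=; rewrite andbT => ss /eqP[<- <-].
move=> I; rewrite cardE /f => I2.
have: [set i in enum I] = I by apply/setP => i; rewrite inE mem_enum.
by case: (enum I) I2 => [|i [|j [|? ?]]] //= _ ->.
Qed.

Lemma sum_card3 h : \sum_(I : {set 'I_n} | #|I| == 3) h (enum I) =
  \sum_(p : 'I_n * 'I_n * 'I_n | (p.1.1 < p.1.2 < p.2)%N) h [:: p.1.1; p.1.2; p.2].
Proof.
pose f I := if enum I is [:: i; j; k] then Some (i, j, k) else None.
rewrite (reindex_omap (fun p : 'I_n * 'I_n * 'I_n =>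
  [set i in [:: p.1.1; p.1.2; p.2]]) f) /=.
  apply: eq_big => [[[i j] k]|[[i j] k] /andP[_]] /=; rewrite /f; last first.
    by case: (enum _) => [|? [|? [|? [|? ?]]]] //= /eqP[-> -> ->].
  apply/andP/idP => [[_]|ij]; last first.
    rewrite enum_sorted_set /= ?eqxx ?cardE ?enum_sorted_set //= /ltI /= andbT //.
  move: (sorted_enum_set [set i0 in [:: i; j; k]]).
  by case: (enum _) => [|? [|? [|? [|? ?]]]] //=; rewrite andbT => ss /eqP[<- <- <-].
move=> I; rewrite cardE /f => I2.
have: [set i in enum I] = I by apply/setP => i; rewrite inE mem_enum.
by case: (enum I) I2 => [|i [|j [|k [|? ?]]]] //= _ ->.
Qed.

(** By trichotomy the diagonal drops out, and the half with j < i is folded onto i < j by exchanging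
    the summations. *)
Lemma sum_pairs (F : 'I_n -> 'I_n -> V) : (forall i, F i i = 0) ->
  \sum_i \sum_j F i j =
  \sum_(p : 'I_n * 'I_n | (p.1 < p.2)%N) (F p.1 p.2 + F p.2 p.1).
Proof.
move=> F0; pose G i j := if (i < j)%N then F i j else 0.
have FE i j : F i j = G i j + (if (j < i)%N then F i j else 0).
  rewrite /G; case: ltngtP => [||/val_inj ->]; rewrite ?addr0 ?add0r ?F0 //.
transitivity (\sum_(i < n) \sum_(j < n) (G i j + if (i < j)%N then F j i else 0)).
  under eq_bigr do under eq_bigr do rewrite FE.
  under eq_bigr do rewrite big_split; rewrite big_split /=.
  under [RHS]eq_bigr do rewrite big_split; rewrite [RHS]big_split /=.
  by congr (_ + _); exact: exchange_big.
rewrite pair_big /= [RHS]big_mkcond; apply: eq_bigr => -[i j] _ /=.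
by rewrite /G; case: ifP; rewrite ?addr0.
Qed.

Lemma sum_triples (F : 'I_n -> 'I_n -> 'I_n -> V) :
  (forall i j, [/\ F i i j = 0, F i j i = 0 & F j i i = 0]) ->
  \sum_i \sum_j \sum_k F i j k =
  \sum_(p : 'I_n * 'I_n * 'I_n | (p.1.1 < p.1.2 < p.2)%N)
    let: (i, j, k) := p in
    F i j k + F i k j + F j i k + F j k i + F k i j + F k j i.
Proof.
move=> F0; pose G (c : bool) i j k := if c then F i j k else 0.
(* The six orderings are listed so that, once the bound indices are renamed to make each of them i <
   j < k, they match the six permuted terms of the goal in order. *)
have FE i j k : F i j k = G (i < j < k)%N i j k + G (i < k < j)%N i j k
  + G (j < i < k)%N i j k + G (k < i < j)%N i j k
  + G (j < k < i)%N i j k + G (k < j < i)%N i j k.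
  rewrite /G; case: (ltngtP i j) => [ij|ji|/val_inj ij]; last first.
  - by rewrite -ij; have [-> _ _] := F0 i k; rewrite !if_same !addr0.
  - case: (ltngtP i k) => [ik|ki|/val_inj ik] /=.
    + by rewrite (ltn_trans ji ik) ltnNge (ltnW (ltn_trans ji ik)) /= ?addr0 ?add0r.
    + case: (ltngtP j k) => [?|?|/val_inj jk] /=; rewrite ?addr0 ?add0r //.
      by rewrite -jk; have [_ _ ->] := F0 j i.
    + by rewrite -ik; have [_ -> _] := F0 i j; rewrite !if_same !addr0.
  - case: (ltngtP j k) => [jk|kj|/val_inj jk] /=.
    + by rewrite (ltn_trans ij jk) ltnNge (ltnW (ltn_trans ij jk)) /= !addr0.
    + case: (ltngtP i k) => [?|?|/val_inj ik] /=; rewrite ?addr0 ?add0r //.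
      by rewrite -ik; have [_ -> _] := F0 i j.
    + by rewrite -jk; have [_ _ ->] := F0 j i; rewrite !if_same !addr0.
transitivity (\sum_(i < n) \sum_(j < n) \sum_(k < n)
  (G (i < j < k)%N i j k + G (i < j < k)%N i k j
   + G (i < j < k)%N j i k + G (i < j < k)%N j k i
   + G (i < j < k)%N k i j + G (i < j < k)%N k j i)).
  under eq_bigr do under eq_bigr do under eq_bigr do rewrite FE.
  have S6 (A1 A2 A3 A4 A5 A6 : 'I_n -> 'I_n -> 'I_n -> V) :
    \sum_i \sum_j \sum_k
      (A1 i j k + A2 i j k + A3 i j k + A4 i j k + A5 i j k + A6 i j k) =
    \sum_i \sum_j \sum_k A1 i j k + \sum_i \sum_j \sum_k A2 i j k
    + \sum_i \sum_j \sum_k A3 i j k + \sum_i \sum_j \sum_k A4 i j k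
    + \sum_i \sum_j \sum_k A5 i j k + \sum_i \sum_j \sum_k A6 i j k.
    rewrite -!big_split; apply: eq_bigr => i _; rewrite -!big_split.
    by apply: eq_bigr => j _; rewrite -!big_split.
  rewrite !S6; congr (_ + _ + _ + _ + _ + _).
  - by apply: eq_bigr => i _; exact: exchange_big.
  - exact: exchange_big.
  - transitivity (\sum_(i < n) \sum_(k < n) \sum_(j < n) G (k < i < j)%N i j k).
      by apply: eq_bigr => i _; exact: exchange_big.
    exact: exchange_big.
  - rewrite exchange_big /=; apply: eq_bigr => i _; exact: exchange_big.
  - rewrite exchange_big /=.
    transitivity (\sum_(i < n) \sum_(k < n) \sum_(j < n) G (k < i < j)%N j i k).
      by apply: eq_bigr => i _; exact: exchange_big.
    exact: exchange_big.
rewrite pair_big /= pair_big /= [RHS]big_mkcond; apply: eq_bigr => -[[i j] k] _ /=.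
by rewrite /G; case: ifP; rewrite ?addr0.
Qed.

End SumsOverSubsets.

(** * Exterior algebra *)

Lemma det_mx22 (R : comRingType) (A : 'M[R]_2) :
  \det A = A 0 0 * A 1 1 - A 0 1 * A 1 0.
Proof.
rewrite (expand_det_row _ 0) !big_ord_recl big_ord0 /cofactor !det_mx11 !mxE /=.
have e0 : lift (0 : 'I_2) (0 : 'I_1) = 1 by exact: val_inj.
have e1 : lift (1 : 'I_2) (0 : 'I_1) = 0 by exact: val_inj.
by rewrite !e0 !e1 /bump /= expr0 expr1; ring.
Qed.

Lemma det_mx33 (R : comRingType) (A : 'M[R]_3) (k := lift 0 1 : 'I_3) :
  \det A = A 0 0 * (A 1 1 * A k k - A 1 k * A k 1)
    - A 0 1 * (A 1 0 * A k k - A 1 k * A k 0)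
    + A 0 k * (A 1 0 * A k 1 - A 1 1 * A k 0).
Proof.
rewrite (expand_det_row _ 0) !big_ord_recl big_ord0 /cofactor !det_mx22 !mxE /=.
have e0 : lift (0 : 'I_3) (0 : 'I_2) = 1 by exact: val_inj.
have e1 : lift (0 : 'I_3) (1 : 'I_2) = k by [].
have e2 : lift (1 : 'I_3) (0 : 'I_2) = 0 by exact: val_inj.
have e3 : lift (1 : 'I_3) (1 : 'I_2) = k by exact: val_inj.
have e4 : lift k (0 : 'I_2) = 0 by exact: val_inj.
have e5 : lift k (1 : 'I_2) = 1 by exact: val_inj.
have e6 : lift (0 : 'I_2) (0 : 'I_1) = 1 by exact: val_inj.
by rewrite e6 ?e0 e1 ?(e1, e2, e3, e4, e5) /bump /= !exprS !expr0; ring.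
Qed.

(** * Degrees, and wedge products evaluated on few vectors *)

Section Degrees.
Context {R : realType} {n : nat}.
Implicit Types (a b c th Y : multilin R n) (s : seq 'rV[R]_n) (u v w : 'rV[R]_n).

(** The degree clause of [alternating] on its own, which passes to contractions, wedge products and
    [dext]. *)
Definition homogeneous (k : nat) th := forall s, size s != k -> th s = 0.

Lemma alternating_homogeneous k th : alternating k th -> homogeneous k th.
Proof. by case. Qed.

Lemma homogeneous_wedge p q a b :
  homogeneous p a -> homogeneous q b -> homogeneous (p + q) (wedge_prod a b).
Proof.
move=> ha hb s; rewrite /wedge_prod; elim: s p q a b ha hb => [|v s IH] p q a b ha hb /=.
  case: p ha => [|p] ha; last by rewrite ha // mul0r.
  by case: q hb => [|q] hb // _; rewrite hb // mulr0.
have contract_hom m th (hth : homogeneous m th) :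
    exists2 m', homogeneous m' (contract_vec v th) &
      forall l, ((size s).+1 != m + l)%N -> (size s != m' + l)%N.
  case: m hth => [|m] hth.
    (* A contracted 0-form vanishes identically, hence is homogeneous of every degree; this degree
       exceeds [size s], which makes the required inequality automatic. *)
    exists (size s).+1 => [t _|l _]; first exact: hth.
    by rewrite addSn neq_ltn ltnS leq_addr.
  by exists m => [t st|l]; [exact: hth | rewrite addSn eqSS].
have [p' ha' hp'] := contract_hom _ _ ha; have [q' hb' hq'] := contract_hom _ _ hb.
move=> ss; rewrite (IH p' q) ?add0r //; last exact: hp'.
apply: (IH p q') => //; last by rewrite addnC; apply: hq'; rewrite addnC.
by move=> t st; rewrite ha ?mulr0.
Qed.

Lemma homogeneous_form1 : homogeneous 0 (form1 : multilin R n).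
Proof. by rewrite /form1 => s /negbTE ->. Qed.

Lemma homogeneous_wedge_seq (T : Type) (f : T -> multilin R n) (l : seq T) :
  (forall i, homogeneous 1 (f i)) -> homogeneous (size l) (wedge_seq (map f l)).
Proof.
move=> hf; elim: l => [|i l IH]; first exact: homogeneous_form1.
exact: (@homogeneous_wedge 1 _ (f i) _ (hf i) IH).
Qed.

Lemma homogeneous_contract_vec k th v :
  homogeneous k.+1 th -> homogeneous k (contract_vec v th).
Proof. by move=> hth s ss; exact: hth. Qed.

Lemma homogeneous_covector xi : homogeneous 1 (covector xi).
Proof. by case=> [|? [|? ?]]. Qed.

Lemma contract_mvE Y th s : homogeneous 2 Y ->
  contract_mv Y th s = \sum_(p : 'I_n * 'I_n | (p.1 < p.2)%N)
     Y [:: evec p.1; evec p.2] * th [:: evec p.2, evec p.1 & s].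
Proof.
move=> hY; rewrite /contract_mv (bigID (fun I : {set 'I_n} => #|I| == 2)) /=.
rewrite [X in _ + X]big1 ?addr0 => [|I cI]; last by rewrite hY ?mul0r // size_map -cardE.
exact: (sum_card2 (fun l => Y (map evec l) * th (rev (map evec l) ++ s))).
Qed.

Lemma homogeneous_contract_mv k Y th : homogeneous 2 Y -> homogeneous k.+2 th ->
  homogeneous k (contract_mv Y th).
Proof.
by move=> hY hth s ss; rewrite contract_mvE // big1 // => p _; rewrite [th _]hth ?mulr0.
Qed.

Lemma wedge12E a b u1 u2 u3 : homogeneous 1 a -> homogeneous 2 b ->
  wedge_prod a b [:: u1; u2; u3] =
  a [:: u1] * b [:: u2; u3] - a [:: u2] * b [:: u1; u3] + a [:: u3] * b [:: u1; u2].
Proof.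
move=> ha hb; have a0 : a [::] = 0 by exact: ha.
have a2 x y l : a [:: x, y & l] = 0 by exact: ha.
rewrite /wedge_prod /= /contract_vec /= a0 !a2 !exprS !expr0; ring.
Qed.

Lemma wedge21E a b u1 u2 u3 : homogeneous 1 a -> homogeneous 2 b ->
  wedge_prod b a [:: u1; u2; u3] = wedge_prod a b [:: u1; u2; u3].
Proof.
move=> ha hb; rewrite [RHS]wedge12E //; have a0 : a [::] = 0 by exact: ha.
have a2 x y l : a [:: x, y & l] = 0 by exact: ha.
rewrite /wedge_prod /= /contract_vec /= a0 !a2 !exprS !expr0; ring.
Qed.

(** The six (2,2)-shuffles pair up under exchange of the two equal factors, whence the factor 2. *)
Lemma wedge22E b u1 u2 u3 u4 : homogeneous 2 b ->
  wedge_prod b b [:: u1; u2; u3; u4] =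
  2 * (b [:: u1; u2] * b [:: u3; u4] - b [:: u1; u3] * b [:: u2; u4]
       + b [:: u1; u4] * b [:: u2; u3]).
Proof.
move=> hb; have b0 : b [::] = 0 by exact: hb.
have b1 x : b [:: x] = 0 by exact: hb.
have b3 x y z l : b [:: x, y, z & l] = 0 by exact: hb.
rewrite /wedge_prod /= /contract_vec /= b0 !b1 !b3 !exprS !expr0; ring.
Qed.

(** The 3 x 3 determinant of the values, expanded along the row of [a]. *)
Lemma wedge_seq3E a b c u1 u2 u3 :
  homogeneous 1 a -> homogeneous 1 b -> homogeneous 1 c ->
  wedge_seq [:: a; b; c] [:: u1; u2; u3] =
  a [:: u1] * (b [:: u2] * c [:: u3] - b [:: u3] * c [:: u2])
  - a [:: u2] * (b [:: u1] * c [:: u3] - b [:: u3] * c [:: u1])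
  + a [:: u3] * (b [:: u1] * c [:: u2] - b [:: u2] * c [:: u1]).
Proof.
move=> ha hb hc.
have hf : homogeneous 1 (wedge_prod c form1).
  by apply: (@homogeneous_wedge 1 0) => //; exact: homogeneous_form1.
have cE v : wedge_prod c form1 [:: v] = c [:: v].
  by rewrite /wedge_prod /= /contract_vec /= /form1 /= mulr0 addr0 mulr1.
have hbc : homogeneous 2 (wedge_prod b (wedge_prod c form1)).
  exact: (@homogeneous_wedge 1 1).
have bcE v w : wedge_prod b (wedge_prod c form1) [:: v; w] =
    b [:: v] * c [:: w] - b [:: w] * c [:: v].
  move: (wedge_prod c form1) hf cE => f hf cE.
  have b0 : b [::] = 0 by exact: hb.
  have b2 x y l : b [:: x, y & l] = 0 by exact: hb.
  by rewrite {1}/wedge_prod /= /contract_vec /= b0 !b2 !cE !exprS !expr0; ring.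
rewrite -[LHS]/(wedge_prod a (wedge_prod b (wedge_prod c form1)) [:: u1; u2; u3]).
by rewrite wedge12E // !bcE.
Qed.

(* Permuting the factors by sg permutes the rows of the determinant
   (b(v_i, u_j))_ij, which compensates the sign of sg. *)
Lemma sharp_wedge3E b (T : multilin R n) u1 u2 u3 : homogeneous 2 b ->
  sharp_wedge [:: b; b; b] T [:: u1; u2; u3] =
  6 * \sum_(p : 'I_n * 'I_n * 'I_n | (p.1.1 < p.1.2 < p.2)%N)
    let: (i, j, k) := p in let e := @evec R n in
    T [:: e i; e j; e k] *
    (b [:: e i; u1] * (b [:: e j; u2] * b [:: e k; u3] - b [:: e j; u3] * b [:: e k; u2])
    - b [:: e i; u2] * (b [:: e j; u1] * b [:: e k; u3] - b [:: e j; u3] * b [:: e k; u1])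
    + b [:: e i; u3] * (b [:: e j; u1] * b [:: e k; u2] - b [:: e j; u2] * b [:: e k; u1])).
Proof.
move=> hb; rewrite /sharp_wedge /=.
pose D (l : seq 'I_n) (sg : 'S_3) :=
  wedge_seq [seq contract_vec (nth 0 (map evec l) (sg i))
                   (nth form1 [:: b; b; b] i) | i <- enum 'I_3] [:: u1; u2; u3].
rewrite (sum_card3 (fun l => T (map evec l) * \sum_(sg : 'S_3) (-1) ^+ sg * D l sg)).
rewrite mulr_sumr; apply: eq_bigr => -[[i j] k] _ /=.
rewrite [RHS]mulrCA; congr (_ * _).
pose A := \matrix_(r < 3, q < 3)
  b [:: nth 0 [:: evec i; evec j; evec k] r; nth 0 [:: u1; u2; u3] q].
have hbv v : homogeneous 1 (contract_vec v b) by exact: homogeneous_contract_vec.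
have DE sg : D [:: i; j; k] sg = (-1) ^+ sg * \det A.
  rewrite -det_perm -det_mulmx -row_permE det_mx33 !mxE.
  rewrite /D enum_ordSl enum_ordSl enum_ordSl enum_ord0 [X in wedge_seq X]/=.
  have e1 : lift ord0 ord0 = 1 :> 'I_3 by exact: val_inj.
  have e2 : lift ord0 (lift ord0 ord0) = lift 0 1 :> 'I_3 by exact: val_inj.
  by rewrite wedge_seq3E // e1 e2.
under eq_bigr do rewrite DE mulrA -expr2 sqrr_sign mul1r.
rewrite sumr_const card_Sn -[LHS]mulr_natl.
by rewrite det_mx33 !mxE.
Qed.

End Degrees.

(** * The Maurer-Cartan expression in a chart *)

Section LocalCalculus.
Context {R : realType} {n : nat} (U : set 'rV[R]_n) (x : 'rV[R]_n).
Hypotheses (oU : open U) (Ux : U x).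
Implicit Types (f g : 'rV[R]_n -> R) (w b z : localfield R n) (u v : 'rV[R]_n).

Let e := @evec R n.

Let near_U : \near x, U x.
Proof. exact: open_nbhs_nbhs. Qed.

Lemma derive_eq_on f g v : (forall y, U y -> f y = g y) -> 'D_v f x = 'D_v g x.
Proof. by move=> fg; apply: near_eq_derive; exact: filterS near_U. Qed.

Lemma is_derive_eq_on f g v df : (forall y, U y -> f y = g y) ->
  is_derive x v f df -> is_derive x v g df.
Proof. by move=> fg; apply: near_eq_is_derive; exact: filterS near_U. Qed.

Lemma is_derive_mul f g v df dg : is_derive x v f df -> is_derive x v g dg ->
  is_derive x v (fun y => f y * g y) (df * g x + f x * dg).
Proof.
move=> hf hg; apply: (@is_derive_eq _ _ _ _ _ _ _ _ (is_deriveM hf hg)).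
by rewrite /GRing.scale /= addrC [g x * _]mulrC.
Qed.

Lemma is_derive_bigsum I (r : seq I) (P : pred I) (F : I -> 'rV[R]_n -> R) dF v :
  (forall i, is_derive x v (F i) (dF i)) ->
  is_derive x v (fun y => \sum_(i <- r | P i) F i y) (\sum_(i <- r | P i) dF i).
Proof.
move=> hF; elim: r => [|i r IH].
  under [X in is_derive _ _ X _]eq_fun do rewrite big_nil.
  by rewrite big_nil; exact: is_derive_cst.
under [X in is_derive _ _ X _]eq_fun do rewrite big_cons.
rewrite big_cons; case: (P i) => //; exact: is_deriveD.
Qed.

Lemma dext1E w u : dext w x [:: u] = 'D_u (fun y => w y [::]) x.
Proof. by rewrite /dext big_ord_recl big_ord0 /= expr0 mul1r addr0. Qed.

Lemma dext2E w u1 u2 : dext w x [:: u1; u2] =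
  'D_u1 (fun y => w y [:: u2]) x - 'D_u2 (fun y => w y [:: u1]) x.
Proof. by rewrite /dext !big_ord_recl big_ord0 /= /bump /= !exprS expr0; ring. Qed.

Lemma dext3E w u1 u2 u3 : dext w x [:: u1; u2; u3] =
  'D_u1 (fun y => w y [:: u2; u3]) x - 'D_u2 (fun y => w y [:: u1; u3]) x
  + 'D_u3 (fun y => w y [:: u1; u2]) x.
Proof. by rewrite /dext !big_ord_recl big_ord0 /= /bump /= !exprS expr0; ring. Qed.

Lemma dext5E w u1 u2 u3 u4 u5 : dext w x [:: u1; u2; u3; u4; u5] =
  'D_u1 (fun y => w y [:: u2; u3; u4; u5]) x
  - 'D_u2 (fun y => w y [:: u1; u3; u4; u5]) x
  + 'D_u3 (fun y => w y [:: u1; u2; u4; u5]) x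
  - 'D_u4 (fun y => w y [:: u1; u2; u3; u5]) x
  + 'D_u5 (fun y => w y [:: u1; u2; u3; u4]) x.
Proof. by rewrite /dext !big_ord_recl big_ord0 /= /bump /= !exprS expr0; ring. Qed.

Lemma homogeneous_dext k w :
  (forall y, U y -> homogeneous k (w y)) -> homogeneous k.+1 (dext w x).
Proof.
move=> hw s ss; rewrite /dext big1 // => i _.
rewrite (@derive_eq_on _ (cst 0)); first by rewrite derive_cst mulr0.
move=> y /hw ->//; rewrite size_cat size_take size_drop ltn_ord.
case: i => i /= ilt; apply: contra ss => /eqP <-.
by rewrite -addnS -subSn // subSS subnKC // ltnW.
Qed.

Lemma homogeneous_lie k w z : (forall y, U y -> homogeneous 2 (z y)) ->
  (forall y, U y -> homogeneous k.+1 (w y)) -> homogeneous k (lie 2 z w x).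
Proof.
move=> hz hw s ss; rewrite /lie {1}/lcontract.
rewrite (@homogeneous_contract_mv _ _ k) //; [|exact: hz|exact: homogeneous_dext].
rewrite sub0r; apply/eqP; rewrite oppr_eq0 mulf_eq0; apply/orP; right; apply/eqP.
(* For [k = 0] the form has degree 1 and its contraction with a bivector is zero;
   [homogeneous_contract_mv] covers degrees at least 2. *)
case: k hw ss => [|k] hw ss; last first.
  apply: homogeneous_dext ss => y Uy.
  by apply: homogeneous_contract_mv; [exact: hz|exact: hw].
rewrite /dext big1 // => i _.
rewrite (@derive_eq_on _ (cst 0)); first by rewrite derive_cst mulr0.
move=> y Uy; rewrite /lcontract contract_mvE ?big1 //; last exact: hz.
by move=> p _; rewrite (hw _ Uy) ?mulr0.
Qed.

End LocalCalculus.

(** * Coordinate formulas for the brackets and the Maurer-Cartan expression *)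

Section MaurerCartanLocal.
Context {R : realType} {n : nat} (U : set 'rV[R]_n) (x : 'rV[R]_n).
Hypotheses (oU : open U) (Ux : U x).
Variables (b z : localfield R n).
Hypotheses (alt_b : forall y, U y -> alternating 2 (b y))
  (smooth_b : forall s, smooth_on U (fun y => b y s))
  (alt_z : forall y, U y -> alternating 2 (z y))
  (smooth_z : forall s, smooth_on U (fun y => z y s)).
Implicit Types (u v : 'rV[R]_n) (i j k : 'I_n).

Let e := @evec R n.
Let Z i j := z x [:: e i; e j].
Let Db v u1 u2 := 'D_v (fun y => b y [:: u1; u2]) x.
Let DZ v i j := 'D_v (fun y => z y [:: e i; e j]) x.

Let hom_b y : U y -> homogeneous 2 (b y).
Proof. by move/alt_b/alternating_homogeneous. Qed.

Let hom_z y : U y -> homogeneous 2 (z y).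
Proof. by move/alt_z/alternating_homogeneous. Qed.

Let bC u v : b x [:: v; u] = - b x [:: u; v].
Proof. exact/alternating2C/alt_b. Qed.

Let ZC i j : Z j i = - Z i j.
Proof. exact/alternating2C/alt_z. Qed.

Let is_derive_b v u1 u2 : is_derive x v (fun y => b y [:: u1; u2]) (Db v u1 u2).
Proof. exact/derivableP/smooth_on_derivable. Qed.

Let is_derive_z v i j : is_derive x v (fun y => z y [:: e i; e j]) (DZ v i j).
Proof. exact/derivableP/smooth_on_derivable. Qed.

Let DbC v u1 u2 : Db v u2 u1 = - Db v u1 u2.
Proof.
rewrite /Db -deriveN; last exact: smooth_on_derivable.
by apply: (derive_eq_on oU Ux) => y /alt_b /alternating2C ->.
Qed.

Let DZC v i j : DZ v j i = - DZ v i j.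
Proof.
rewrite /DZ -deriveN; last exact: smooth_on_derivable.
by apply: (derive_eq_on oU Ux) => y /alt_z /alternating2C ->.
Qed.

Let Zii i : Z i i = 0.
Proof. by have [_ _ alt] := alt_z Ux; exact: (alt [::] [::] [::]). Qed.

Let DZii v i : DZ v i i = 0.
Proof.
rewrite /DZ (derive_eq_on (g := cst 0) oU Ux); first exact: derive_cst.
by move=> y Uy; have [_ _ alt] := alt_z Uy; exact: (alt [::] [::] [::]).
Qed.

(** Leibniz rule. The indices of [dw] are reversed because contraction with e_i /\ e_j inserts e_j
    first and e_i second. *)
Let derive_contract (w : localfield R n) (dw : 'I_n -> 'I_n -> R) v s :
  (forall i j, is_derive x v (fun y => w y [:: e j, e i & s]) (dw j i)) ->
  'D_v (fun y => contract_mv (z y) (w y) s) x =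
  \sum_(p : 'I_n * 'I_n | (p.1 < p.2)%N)
    (DZ v p.1 p.2 * w x [:: e p.2, e p.1 & s] + Z p.1 p.2 * dw p.2 p.1).
Proof.
move=> hw; apply: derive_val; apply: (is_derive_eq_on oU Ux
  (f := fun y => \sum_(p : 'I_n * 'I_n | (p.1 < p.2)%N)
     z y [:: e p.1; e p.2] * w y [:: e p.2, e p.1 & s])).
  by move=> y /hom_z hy; rewrite contract_mvE.
by apply: is_derive_bigsum => p; exact: (is_derive_mul (is_derive_z _ _ _) (hw _ _)).
Qed.

(** For a bivector L_Z = iota_Z d - d iota_Z; the terms Z_ij D_u b(e_j, e_i) cancel between the two
    parts. *)
Let lie_b u : lie 2 z b x [:: u] =
  \sum_(p : 'I_n * 'I_n | (p.1 < p.2)%N) let (i, j) := p in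
    (Z i j * (Db (e j) (e i) u - Db (e i) (e j) u) - DZ u i j * b x [:: e j; e i]).
Proof.
rewrite /lie /lcontract contract_mvE; last exact: hom_z.
rewrite dext1E (derive_contract (s := [::]) (dw := fun j i => Db u (e j) (e i))
  (fun i j => is_derive_b u (e j) (e i))).
rewrite sqrrN expr1n mul1r -sumrB; apply: eq_bigr => -[i j] _ /=.
by rewrite dext3E -/e; rewrite /Z /Db; ring.
Qed.

Let Dbb v (u1 u2 u3 u4 : 'rV[R]_n) :=
  2 * (Db v u1 u2 * b x [:: u3; u4] + b x [:: u1; u2] * Db v u3 u4
     - (Db v u1 u3 * b x [:: u2; u4] + b x [:: u1; u3] * Db v u2 u4)
     + (Db v u1 u4 * b x [:: u2; u3] + b x [:: u1; u4] * Db v u2 u3)).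

Let is_derive_bb v u1 u2 u3 u4 :
  is_derive x v (fun y => lwedge b b y [:: u1; u2; u3; u4]) (Dbb v u1 u2 u3 u4).
Proof.
apply: (is_derive_eq_on oU Ux (f := fun y =>
  2 * (b y [:: u1; u2] * b y [:: u3; u4] - b y [:: u1; u3] * b y [:: u2; u4]
       + b y [:: u1; u4] * b y [:: u2; u3]))).
  by move=> y Uy; rewrite /lwedge wedge22E //; exact: hom_b.
apply: is_deriveZ; apply: is_deriveD; last first.
  exact: (is_derive_mul (is_derive_b _ _ _) (is_derive_b _ _ _)).
by apply: is_deriveB; exact: (is_derive_mul (is_derive_b _ _ _) (is_derive_b _ _ _)).
Qed.

(** As in [lie_b], the derivatives of the form along the arguments [u1], [u2], [u3] cancel. *)
Let lie_bb u1 u2 u3 : lie 2 z (lwedge b b) x [:: u1; u2; u3] =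
  \sum_(p : 'I_n * 'I_n | (p.1 < p.2)%N) let (i, j) := p in
    (Z i j * (Dbb (e j) (e i) u1 u2 u3 - Dbb (e i) (e j) u1 u2 u3)
     - DZ u1 i j * lwedge b b x [:: e j; e i; u2; u3]
     + DZ u2 i j * lwedge b b x [:: e j; e i; u1; u3]
     - DZ u3 i j * lwedge b b x [:: e j; e i; u1; u2]).
Proof.
have D v v1 v2 : 'D_v (fun y => lcontract z (lwedge b b) y [:: v1; v2]) x =
  \sum_(p : 'I_n * 'I_n | (p.1 < p.2)%N)
    (DZ v p.1 p.2 * lwedge b b x [:: e p.2; e p.1; v1; v2]
     + Z p.1 p.2 * Dbb v (e p.2) (e p.1) v1 v2).
    exact: (derive_contract (dw := fun j i => Dbb v (e j) (e i) v1 v2)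
    (fun i j => is_derive_bb v (e j) (e i) v1 v2)).
rewrite /lie {1}/lcontract contract_mvE; last exact: hom_z.
rewrite dext3E !D sqrrN expr1n mul1r -!sumrB -big_split -sumrB /=.
apply: eq_bigr => -[i j] _ /=; rewrite dext5E.
have DE v v1 v2 v3 v4 :
    'D_v (fun y => lwedge b b y [:: v1; v2; v3; v4]) x = Dbb v v1 v2 v3 v4.
  exact: derive_val.
by rewrite !DE -/e -/(Z i j); move: (Z i j) Dbb => zij F; ring.
Qed.

(** The part of [twist_derive u1 u2 u3] of degree 1 in Z: b differentiated along Z^#(b^# u1), and Z
    differentiated along u1. *)
Let A (u1 u2 u3 : 'rV[R]_n) i j :=
  b x [:: u1; e i] * Z i j * Db (e j) u2 u3
  + DZ u1 i j * b x [:: u2; e i] * b x [:: u3; e j].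

(** Both sides are turned into sums over i < j, and the summands agree as polynomials in the
    coefficients and their first derivatives. *)
Lemma half_lam2E u1 u2 u3 : 2^-1 * lam2 z 2 b b x [:: u1; u2; u3] =
  \sum_i \sum_j (A u1 u2 u3 i j + A u2 u3 u1 i j + A u3 u1 u2 i j).
Proof.
rewrite [RHS]sum_pairs => [|i]; last by rewrite /A Zii !DZii; ring.
have hL : homogeneous 1 (lie 2 z b x).
  by apply: (homogeneous_lie oU Ux) => y; [exact: hom_z|exact: hom_b].
have hb := hom_b Ux.
have lwE (c d : localfield R n) s : lwedge c d x s = wedge_prod (c x) (d x) s by [].
rewrite /lam2 !lwE (wedge21E _ _ _ hL hb) (wedge12E _ _ _ hL hb) lie_bb !lie_b.
rewrite sqrrN expr1n mul1r.
rewrite !mulr_suml -!sumrB -!big_split -!sumrB -sumrN mulr_sumr /=.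
apply: eq_bigr => -[i j] _ /=.
(* Skew-symmetry brings the arguments to a common order, so that equal terms become equal atoms for
   [field]. *)
rewrite /A !lwE !wedge22E // /Dbb (ZC i j) (bC (e i) (e j)).
rewrite ?(bC (e i) u1) ?(bC (e i) u2) ?(bC (e i) u3).
rewrite ?(bC (e j) u1) ?(bC (e j) u2) ?(bC (e j) u3).
rewrite ?(bC u1 u2) ?(bC u1 u3) ?(bC u2 u3).
rewrite (DZC u1 i j) (DZC u2 i j) (DZC u3 i j) (DbC (e j) u1 u3) (DbC (e i) u1 u3).
by move: (b x) (Z i j) Db DZ => bx zij Db' DZ'; field.
Qed.

(** The derivative of Z_jk along Z^# e^i; its cyclic sum over (i, j, k) is the coefficient of [Z, Z]
    / 2, by [schouten_zz]. *)
Let W i j k := \sum_a Z i a * DZ (e a) j k.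

Let sum_delta (F : 'I_n -> R) j : \sum_i F i * (i == j)%:R = F j.
Proof.
rewrite (bigD1 j) //= eqxx mulr1 big1 ?addr0 // => i /negbTE ->.
by rewrite mulr0.
Qed.

Let evecE i j : e i 0 j = (i == j)%:R.
Proof. by rewrite mxE eqxx eq_sym. Qed.

Let covector_e i v : covector (e i) [:: v] = v 0 i.
Proof. by rewrite /= /e /evec trmx_delta -colE mxE. Qed.

(** The constant form on which [schouten] evaluates the commutator for the arguments e^i, e^j, e^k,
    in the reversed order prescribed there. *)
Let const3 i j k : localfield R n := fun=> wedge_seq (map covector [:: e k; e j; e i]).

Let contract_const3 i j k v y : U y -> lcontract z (const3 i j k) y [:: v] =
  z y [:: e i; e j] * v 0 k - z y [:: e i; e k] * v 0 j + z y [:: e j; e k] * v 0 i.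
Proof.
move=> Uy; rewrite /lcontract contract_mvE; last exact: hom_z.
(* [G] is chosen so that G c d + G d c is Z_cd times the value of [const3] on (e_d, e_c, v), a
   determinant of Kronecker deltas and coordinates of [v]. *)
pose G c d := z y [:: e c; e d] * v 0 i * (c == j)%:R * (d == k)%:R
  - z y [:: e c; e d] * v 0 j * (c == i)%:R * (d == k)%:R
  + z y [:: e c; e d] * v 0 k * (c == i)%:R * (d == j)%:R.
transitivity (\sum_c \sum_d G c d); last first.
  rewrite /G.
  under eq_bigr do rewrite big_split sumrB /= !sum_delta.
  by rewrite big_split sumrB /= !sum_delta; ring.
rewrite sum_pairs => [|c]; last first.
  have [_ _ alt] := alt_z Uy; rewrite /G (alt [::] [::] [::]); ring.
apply: eq_bigr => -[c d] _; rewrite [LHS]/=.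
have -> : const3 i j k y [:: e d; e c; v] = _ := wedge_seq3E (e d) (e c) v
  (@homogeneous_covector _ _ (e k)) (@homogeneous_covector _ _ (e j))
  (@homogeneous_covector _ _ (e i)).
rewrite !covector_e !evecE /G (alternating2C (e c) (e d) (alt_z Uy)).
by move: (z y) => zy; ring.
Qed.

Let D_contract_const3 w i j k v :
  'D_w (fun y => lcontract z (const3 i j k) y [:: v]) x =
  DZ w i j * v 0 k - DZ w i k * v 0 j + DZ w j k * v 0 i.
Proof.
rewrite (derive_eq_on oU Ux w (@contract_const3 i j k v)).
have D c d a : is_derive x w (fun y => z y [:: e c; e d] * a) (DZ w c d * a).
  apply: (is_derive_eq (is_derive_mul (is_derive_z w c d) (is_derive_cst a x w))).
  by rewrite mulr0 addr0.
apply: (derive_val (is_derive := is_deriveD (is_deriveB (D i j _) (D i k _)) (D j k _))).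
Qed.

(** On the closed form w = [const3 i j k] the commutator is twice iota_Z d iota_Z w: the term iota_Z
    d w vanishes, and d iota_Z iota_Z w has no component in degree 0. *)
Let schouten_zz i j k :
  schouten 2 2 z z x [:: e i; e j; e k] = 2 * (W i j k - W j i k + W k i j).
Proof.
have dconst s : dext (const3 i j k) x s = 0.
  by rewrite /dext big1 // => l _; rewrite derive_cst mulr0.
have dnil w : dext w x [::] = 0 :> R by rewrite /dext big_ord0.
have lie_const s : lie 2 z (const3 i j k) x s = - dext (lcontract z (const3 i j k)) x s.
  rewrite /lie {1}/lcontract contract_mvE; last exact: hom_z.
  rewrite big1 => [|p _]; last by rewrite dconst mulr0.
  by rewrite sqrrN expr1n mul1r sub0r.
rewrite -[LHS]/(lie_contract_comm 2 2 z z (const3 i j k) x [::]).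
rewrite /lie_contract_comm {1}/lie dnil mulr0 subr0 /lcontract.
rewrite !contract_mvE; try exact: hom_z.
rewrite /= mul1n sqrrN expr1n mul1r -/(lcontract z (const3 i j k)).
under [X in _ - X]eq_bigr do rewrite lie_const mulrN.
rewrite sumrN opprK -mulr2n -[LHS]mulr_natl; congr (_ * _).
pose H a c := Z a c * 'D_(e c) (fun y => lcontract z (const3 i j k) y [:: e a]) x.
transitivity (\sum_a \sum_c H a c).
  rewrite sum_pairs => [|a]; last by rewrite /H Zii mul0r.
  by apply: eq_bigr => -[a c] _ /=; rewrite dext2E /H (ZC a c) /Z; ring.
have HE a : \sum_c H a c =
    W a i j * (a == k)%:R - W a i k * (a == j)%:R + W a j k * (a == i)%:R.
  rewrite /W !mulr_suml -sumrB -big_split; apply: eq_bigr => c _ /=.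
  by rewrite /H D_contract_const3 !evecE; ring.
under eq_bigr do rewrite HE.
by rewrite big_split sumrB /= !sum_delta; ring.
Qed.

Let WC i j k : W i k j = - W i j k.
Proof. by rewrite /W -sumrN; apply: eq_bigr => a _; rewrite DZC mulrN. Qed.

Let Wii i j : W i j j = 0.
Proof. by rewrite /W big1 // => a _; rewrite DZii mulr0. Qed.

(** The part of [twist_derive u1 u2 u3] of degree 2 in Z. *)
Let B (u1 u2 u3 : 'rV[R]_n) i j k :=
  W i j k * (b x [:: u1; e i] * b x [:: u2; e j] * b x [:: u3; e k]).

Let sum_rot (G : 'I_n -> 'I_n -> 'I_n -> R) :
  \sum_i \sum_j \sum_k G j k i = \sum_i \sum_j \sum_k G i j k.
Proof. by rewrite exchange_big; apply: eq_bigr => j _; exact: exchange_big. Qed.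

Let sum2D (G1 G2 G3 : 'I_n -> 'I_n -> R) :
  \sum_i \sum_j (G1 i j + G2 i j + G3 i j) =
  \sum_i \sum_j G1 i j + \sum_i \sum_j G2 i j + \sum_i \sum_j G3 i j.
Proof. by rewrite -!big_split; apply: eq_bigr => i _; rewrite -!big_split. Qed.

Let sum3D (G1 G2 G3 : 'I_n -> 'I_n -> 'I_n -> R) :
  \sum_i \sum_j \sum_k (G1 i j k + G2 i j k + G3 i j k) =
  \sum_i \sum_j \sum_k G1 i j k + \sum_i \sum_j \sum_k G2 i j k
  + \sum_i \sum_j \sum_k G3 i j k.
Proof. by rewrite -!big_split; apply: eq_bigr => i _; exact: sum2D. Qed.

Lemma sixth_lam3E u1 u2 u3 : 6^-1 * lam3 z 2 b b b x [:: u1; u2; u3] =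
  \sum_i \sum_j \sum_k (B u1 u2 u3 i j k + B u2 u3 u1 i j k + B u3 u1 u2 i j k).
Proof.
(* The first factor is the coefficient of [Z, Z] / 2; the factor 6 in [sharp_wedge3E] cancels
   against 1/6. *)
pose F i j k := (W i j k - W j i k + W k i j) *
  (b x [:: u1; e i] * b x [:: u2; e j] * b x [:: u3; e k]).
transitivity (\sum_i \sum_j \sum_k F i j k).
  rewrite sum_triples => [|i j]; last by rewrite /F !Wii (WC i j i); split; ring.
  rewrite /lam3 sharp_wedge3E; last exact: hom_b.
  rewrite mulrCA mulKf ?pnatr_eq0 // mulr_sumr.
  apply: eq_bigr => -[[i j] k] _ /=; rewrite schouten_zz /F.
  rewrite !(WC _ i j, WC _ i k, WC _ j k).
  (* Reversing the arguments in three factors b(e, u) gives (-1)^3, which absorbs the sign in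
     [lam3]. *)
  rewrite ?(bC (e i) u1) ?(bC (e i) u2) ?(bC (e i) u3).
  rewrite ?(bC (e j) u1) ?(bC (e j) u2) ?(bC (e j) u3).
  rewrite ?(bC (e k) u1) ?(bC (e k) u2) ?(bC (e k) u3) !exprS expr0.
  by move: (b x) W => bx W'; field.
have FE i j k : F i j k = B u1 u2 u3 i j k + B u2 u3 u1 j k i + B u3 u1 u2 k i j.
  by rewrite /F /B (WC j i k); ring.
under eq_bigr do under eq_bigr do under eq_bigr do rewrite FE.
have rot2 : \sum_i \sum_j \sum_k B u3 u1 u2 k i j = \sum_i \sum_j \sum_k B u3 u1 u2 i j k.
  exact: esym (sum_rot (fun i j k => B u3 u1 u2 k i j)).
by rewrite !sum3D (sum_rot (B u2 u3 u1)) rot2.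
Qed.

(* u N for N = 1 + BZ, i.e. u + Z^#(beta^# u). *)
Definition twist u : 'rV[R]_n := u *m (1%:M + sharp_mx (b x) *m sharp_mx (z x)).

Let twistE u : twist u = u + \sum_a (\sum_i b x [:: u; e i] * Z i a) *: e a.
Proof.
rewrite /twist mulmxDr mulmx1; congr (_ + _).
rewrite [LHS]row_sum_delta; apply: eq_bigr => a _; congr (_ *: _).
rewrite mulmxA mxE; apply: eq_bigr => i _; rewrite [sharp_mx _ i a]mxE; congr (_ * _).
by rewrite (alternating2_mx _ _ (alt_b Ux)) /e /evec trmx_delta -colE [RHS]mxE.
Qed.

(** Differentiability makes the directional derivative linear in the direction, which [twistE]
    expands in the basis. *)
Let derive_twist (f : 'rV[R]_n -> R) u : differentiable f x ->
  'D_(twist u) f x = 'D_u f x + \sum_i \sum_a b x [:: u; e i] * Z i a * 'D_(e a) f x.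
Proof.
move=> df; rewrite exchange_big /= !deriveE // twistE linearD linear_sum /=.
congr (_ + _); apply: eq_bigr => a _.
by rewrite linearZ /= -mulr_suml deriveE.
Qed.

(* u1 (dB - B dZ B) u2^T, with derivatives in the direction v N; the sign changes
   because the last factor is b(u2, e_j) and not b(e_j, u2). *)
Definition twist_derive v u1 u2 := 'D_(twist v) (fun y => b y [:: u1; u2]) x
  + \sum_i \sum_j 'D_(twist v) (fun y => z y [:: e i; e j]) x
      * (b x [:: u1; e i] * b x [:: u2; e j]).

Lemma maurer_cartan_twist u1 u2 u3 :
  lam1 b x [:: u1; u2; u3] + 2^-1 * lam2 z 2 b b x [:: u1; u2; u3]
  + 6^-1 * lam3 z 2 b b b x [:: u1; u2; u3] =
  twist_derive u1 u2 u3 + twist_derive u2 u3 u1 + twist_derive u3 u1 u2.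
Proof.
rewrite half_lam2E sixth_lam3E /lam1 dext3E.
have CE v1 v2 v3 : twist_derive v1 v2 v3 =
    Db v1 v2 v3 + \sum_i \sum_j A v1 v2 v3 i j + \sum_i \sum_j \sum_k B v1 v2 v3 i j k.
  rewrite /twist_derive.
  have dfb : differentiable (fun y => b y [:: v2; v3]) x.
    exact: smooth_on_differentiable (smooth_b _) Ux.
  have dfz i j : differentiable (fun y => z y [:: e i; e j]) x.
    exact: smooth_on_differentiable (smooth_z _) Ux.
  rewrite derive_twist // -/(Db v1 v2 v3).
  have -> : \sum_i \sum_j A v1 v2 v3 i j =
      \sum_i \sum_j b x [:: v1; e i] * Z i j * Db (e j) v2 v3
      + \sum_i \sum_j DZ v1 i j * (b x [:: v2; e i] * b x [:: v3; e j]).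
    rewrite -big_split; apply: eq_bigr => i _; rewrite -big_split.
    by apply: eq_bigr => j _; rewrite /A mulrA.
  rewrite -!addrA; congr (_ + (_ + _)).
  (* The index paired with [v1] is made innermost, where [derive_twist] produces its sum. *)
  have -> : \sum_i \sum_j \sum_k B v1 v2 v3 i j k =
      \sum_i \sum_j \sum_k B v1 v2 v3 k i j.
    exact: (sum_rot (fun i j k => B v1 v2 v3 k i j)).
  rewrite -big_split; apply: eq_bigr => i _.
  rewrite -big_split; apply: eq_bigr => j _ /=.
  rewrite derive_twist // mulrDl; congr (_ + _); rewrite mulr_suml; apply: eq_bigr => k _.
  rewrite /B /W !mulr_suml; apply: eq_bigr => a _; rewrite -/(DZ (e a) i j).
  by move: (b x) (Z k a) (DZ (e a) i j) => bx t1 t2; ring.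
rewrite (CE u1) (CE u2) (CE u3).
(* The negative middle term of db becomes the cyclic one by skew-symmetry. *)
have -> : 'D_u2 (fun y => b y [:: u1; u3]) x = - Db u2 u3 u1 by exact: DbC.
rewrite sum2D sum3D -/(Db u1 u2 u3) -/(Db u3 u1 u2).
move: (Db u1 u2 u3) (Db u2 u3 u1) (Db u3 u1 u2).
move: (\sum_i \sum_j A u1 u2 u3 i j) (\sum_i \sum_j A u2 u3 u1 i j)
  (\sum_i \sum_j A u3 u1 u2 i j).
move: (\sum_i \sum_j \sum_k B u1 u2 u3 i j k) (\sum_i \sum_j \sum_k B u2 u3 u1 i j k)
  (\sum_i \sum_j \sum_k B u3 u1 u2 i j k) => s1 s2 s3 t1 t2 t3 d1 d2 d3.
by ring.
Qed.

End MaurerCartanLocal.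

(** * The differential of F *)

Section MatrixDerivative.
Context {R : realType} {n : nat} (U : set 'rV[R]_n) (x : 'rV[R]_n).
Hypotheses (oU : open U) (Ux : U x).

Definition derive_mat m p (A : 'rV[R]_n -> 'M[R]_(m, p)) (v : 'rV[R]_n) : 'M[R]_(m, p) :=
  \matrix_(i, j) 'D_v (fun y => A y i j) x.

Lemma derive_mat_eq m p (A B : 'rV[R]_n -> 'M[R]_(m, p)) v :
  (forall y, U y -> A y = B y) -> derive_mat A v = derive_mat B v.
Proof.
move=> AB; apply/matrixP => i j; rewrite !mxE.
by apply: (derive_eq_on oU Ux) => y /AB ->.
Qed.

Lemma derive_mat_cst m p (C : 'M[R]_(m, p)) v : derive_mat (fun=> C) v = 0.
Proof. by apply/matrixP => i j; rewrite !mxE derive_cst. Qed.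

Lemma derive_matD m p (A B : 'rV[R]_n -> 'M[R]_(m, p)) v :
  smooth_mx_on U A -> smooth_mx_on U B ->
  derive_mat (fun y => A y + B y) v = derive_mat A v + derive_mat B v.
Proof.
move=> sA sB; apply/matrixP => i j; rewrite !mxE -deriveD; last 2 first.
- exact: smooth_on_derivable (sA i j) Ux.
- exact: smooth_on_derivable (sB i j) Ux.
by congr derive; apply/funext => y; rewrite mxE.
Qed.

Lemma derive_matM m p q (A : 'rV[R]_n -> 'M[R]_(m, p))
    (B : 'rV[R]_n -> 'M[R]_(p, q)) v :
  smooth_mx_on U A -> smooth_mx_on U B ->
  derive_mat (fun y => A y *m B y) v = derive_mat A v *m B x + A x *m derive_mat B v.
Proof.
move=> sA sB; apply/matrixP => i j; rewrite !mxE -big_split /=.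
have D k : is_derive x v (fun y => A y i k * B y k j)
    ('D_v (fun y => A y i k) x * B x k j + A x i k * 'D_v (fun y => B y k j) x).
  by apply: is_derive_mul; apply/derivableP;
    [exact: smooth_on_derivable (sA i k) Ux|exact: smooth_on_derivable (sB k j) Ux].
have -> : (fun y => (A y *m B y) i j) = (fun y => \sum_k A y i k * B y k j).
  by apply/funext => y; rewrite mxE.
rewrite (derive_val (is_derive := is_derive_bigsum _ _ D)).
by apply: eq_bigr => k _; rewrite !mxE.
Qed.

Lemma smooth_mx_on_cst m p (C : 'M[R]_(m, p)) : smooth_mx_on U (fun=> C).
Proof. by move=> i j; exact: smooth_on_cst. Qed.

Lemma derive_mat_form (A : 'rV[R]_n -> 'M[R]_n) (u v w : 'rV[R]_n) : smooth_mx_on U A ->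
  'D_w (fun y => (u *m A y *m v^T) 0 0) x = (u *m derive_mat A w *m v^T) 0 0.
Proof.
move=> sA; have suA : smooth_mx_on U (fun y => u *m A y).
  by apply: smooth_mx_onM => //; exact: smooth_mx_on_cst.
have := derive_matM w suA (smooth_mx_on_cst v^T).
rewrite derive_mat_cst mulmx0 addr0 (derive_matM w (smooth_mx_on_cst u) sA).
by rewrite derive_mat_cst mul0mx add0r => <-; rewrite mxE.
Qed.

End MatrixDerivative.

(** * The pullback of dF by N *)

Section DifferentialOfF.
Context {R : realType} {n : nat} (U : set 'rV[R]_n).
Hypothesis oU : open U.
Variables (b z : localfield R n).
Hypotheses (alt_b : forall y, U y -> alternating 2 (b y))
  (smooth_b : forall s, smooth_on U (fun y => b y s))
  (alt_z : forall y, U y -> alternating 2 (z y))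
  (smooth_z : forall s, smooth_on U (fun y => z y s))
  (in_I_b : forall y, U y -> in_I (z y) (b y)).
Implicit Types (u v w : 'rV[R]_n).

Let B y := sharp_mx (b y).
Let Z y := sharp_mx (z y).
Let N y := 1%:M + B y *m Z y.
Let F y := invmx (N y) *m B y.

Let smooth_B : smooth_mx_on U B.
Proof. move=> i j; under [X in smooth_on _ X]eq_fun do rewrite mxE; exact: smooth_b. Qed.

Let smooth_Z : smooth_mx_on U Z.
Proof. move=> i j; under [X in smooth_on _ X]eq_fun do rewrite mxE; exact: smooth_z. Qed.

Let smooth_N : smooth_mx_on U N.
Proof.
move=> i j; under [X in smooth_on _ X]eq_fun do rewrite mxE.
apply: smooth_onD => //; first exact: smooth_on_cst.
exact: (smooth_mx_onM oU smooth_B smooth_Z).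
Qed.

Let smooth_F : smooth_mx_on U F.
Proof. by apply: smooth_mx_onM => //; exact: smooth_mx_on_inv. Qed.

Lemma Fmap_alternating y : U y -> alternating 2 (Fmap (z y) (b y)).
Proof.
move=> Uy; apply: alternating_form_of_mx.
by apply: F_skew; [exact/sharp_mx_tr/alt_b|exact/sharp_mx_tr/alt_z|exact: in_I_b].
Qed.

Lemma Fmap_smooth s : smooth_on U (fun y => Fmap (z y) (b y) s).
Proof.
case: s => [|u [|v [|? ?]]]; try exact: smooth_on_cst.
exact: (smooth_mx_onM oU (smooth_mx_onM oU (smooth_mx_on_cst U u) smooth_F)
  (smooth_mx_on_cst U v^T) 0 0).
Qed.

(* Differentiating N F = B gives N dF = dB (1 - ZF) - B dZ F, and
   F N^T = B, (1 - ZF) N^T = 1. *)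
Lemma N_dF_N x w : U x -> N x *m derive_mat x F w *m (N x)^T =
  derive_mat x B w - B x *m derive_mat x Z w *m B x.
Proof.
move=> Ux.
have NF y : U y -> N y *m F y = B y by move=> /in_I_b uN; rewrite mulKVmx.
have := derive_mat_eq oU Ux w NF; rewrite (derive_matM Ux) //.
have dNE : derive_mat x N w = derive_mat x B w *m Z x + B x *m derive_mat x Z w.
  rewrite (derive_matD Ux) ?derive_mat_cst ?add0r ?(derive_matM Ux) //.
    exact: smooth_mx_on_cst.
  exact: smooth_mx_onM.
move=> /(canRL (addKr _)) ->.
have NT : (N x)^T = 1%:M + Z x *m B x.
  by apply: mul_N_tr; [exact/sharp_mx_tr/alt_b|exact/sharp_mx_tr/alt_z].
have FN : F x *m (N x)^T = B x by rewrite NT; apply: mul_F_tr; exact: in_I_b.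
rewrite [LHS]mulmxDl mulNmx -(mulmxA _ (F x)) FN dNE mulmxDl NT mulmxDr mulmx1 mulmxA.
by rewrite opprD addrC !addrA addrK.
Qed.

Lemma dext_Fmap_twist x u1 u2 u3 : U x ->
  dext (fun y => Fmap (z y) (b y)) x
    [:: twist x b z u1; twist x b z u2; twist x b z u3] =
  twist_derive x b z u1 u2 u3 + twist_derive x b z u2 u3 u1 + twist_derive x b z u3 u1 u2.
Proof.
move=> Ux; set t := twist x b z.
have ab := alt_b Ux.
have bl v i : (v *m B x) 0 i = b x [:: v; evec i].
  by rewrite (alternating2_mx _ _ ab) /evec trmx_delta -colE [RHS]mxE.
have br v j : (B x *m v^T) j 0 = - b x [:: v; evec j].
  by rewrite -alternating2C // (alternating2_mx _ _ ab) -mulmxA /evec -rowE [RHS]mxE.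
(* [t] is taken at the fixed point [x], so [t v1] and [t v2] are constant in [y]; only F is
   differentiated, and N dF N^T appears. *)
have D w v1 v2 : 'D_(t w) (fun y => Fmap (z y) (b y) [:: t v1; t v2]) x =
    twist_derive x b z w v1 v2.
  rewrite (derive_mat_form oU Ux _ _ _ smooth_F) -/(t w).
  have -> : t v1 *m derive_mat x F (t w) *m (t v2)^T =
      v1 *m (N x *m derive_mat x F (t w) *m (N x)^T) *m v2^T.
    by rewrite /t /twist trmx_mul !mulmxA.
  rewrite N_dF_N // mulmxBr mulmxBl mxE [X in _ + X]mxE; congr (_ + _).
    rewrite -(derive_mat_form oU Ux _ _ _ smooth_B).
    by apply: (derive_eq_on oU Ux) => y /alt_b aby; rewrite [RHS]alternating2_mx.
  rewrite !mulmxA -(mulmxA _ (B x)) -(mulmxA _ (derive_mat x Z (t w))).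
  rewrite mxE -sumrN; apply: eq_bigr => i _.
  rewrite bl [X in _ * X]mxE mulr_sumr -sumrN; apply: eq_bigr => j _.
  have -> : derive_mat x Z (t w) i j = 'D_(t w) (fun y => z y [:: evec i; evec j]) x.
    by rewrite mxE; congr derive; apply/funext => y; rewrite mxE.
  by rewrite br; move: (b x) => bx; ring.
rewrite dext3E !D; congr (_ + _ + _).
(* The negative middle term of [dext3E] is made cyclic by the skew-symmetry of F. *)
rewrite -!D -deriveN; last exact: smooth_on_derivable (Fmap_smooth _) Ux.
by apply: (derive_eq_on oU Ux) => y /Fmap_alternating /alternating2C ->.
Qed.

End DifferentialOfF.

(** * Equivalence of the two conditions *)

Section LocalEquivalence.
Context {R : realType} {n : nat} (U : set 'rV[R]_n).
Hypothesis oU : open U.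
Variables (b z : localfield R n).
Hypotheses (alt_b : forall y, U y -> alternating 2 (b y))
  (smooth_b : forall s, smooth_on U (fun y => b y s))
  (alt_z : forall y, U y -> alternating 2 (z y))
  (smooth_z : forall s, smooth_on U (fun y => z y s))
  (in_I_b : forall y, U y -> in_I (z y) (b y)).

(** Since [lam1], [lam2] and [lam3] are defined on sequences of every length, this reduces the
    Maurer-Cartan equation to triples of vectors. *)
Lemma homogeneous_maurer_cartan x : U x ->
  homogeneous 3 (fun s => lam1 b x s + 2^-1 * lam2 z 2 b b x s
    + 6^-1 * lam3 z 2 b b b x s).
Proof.
move=> Ux s s3.
have hb y : U y -> homogeneous 2 (b y) by move/alt_b/alternating_homogeneous.
have hz y : U y -> homogeneous 2 (z y) by move/alt_z/alternating_homogeneous.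
have hL : homogeneous 1 (lie 2 z b x) by exact: (homogeneous_lie oU Ux).
have hLL : homogeneous 3 (lie 2 z (lwedge b b) x).
  apply: (homogeneous_lie oU Ux) => // y Uy.
  by apply: (@homogeneous_wedge _ _ 2 2); exact: hb.
rewrite /lam1 (homogeneous_dext oU Ux hb) // add0r.
have lwE (c d : localfield R n) t : lwedge c d x t = wedge_prod (c x) (d x) t by [].
rewrite /lam2 !lwE hLL // (@homogeneous_wedge _ _ 1 2 _ _ hL (hb _ Ux)) //.
rewrite (@homogeneous_wedge _ _ 2 1 _ _ (hb _ Ux) hL) // /lam3 /sharp_wedge.
rewrite [X in _ + _ * (_ * X)]big1 ?mulr0 ?subr0 ?oppr0 ?mulr0 ?addr0 // => I _.
rewrite big1 ?mulr0 // => sg _.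
set f := fun i : 'I_3 => _ ; rewrite (@homogeneous_wedge_seq _ _ _ f) ?mulr0 ?size_enum_ord //.
move=> i; apply: homogeneous_contract_vec.
by case: i => [[|[|[|]]]] //= _; exact: hb.
Qed.

(** N is invertible, so every triple of vectors is a twisted triple, and the pullback of dF vanishes
    exactly when dF does. Other lengths are settled by degree. *)
Lemma maurer_cartan_iff_closed x : U x ->
  (forall s, lam1 b x s + 2^-1 * lam2 z 2 b b x s + 6^-1 * lam3 z 2 b b b x s = 0) <->
  (forall s, dext (fun y => Fmap (z y) (b y)) x s = 0).
Proof.
move=> Ux.
have hd : homogeneous 3 (dext (fun y => Fmap (z y) (b y)) x).
  apply: (homogeneous_dext oU Ux) => y Uy; apply: alternating_homogeneous.
  exact: (Fmap_alternating (U := U)).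
have twistK v : twist x b z (v *m invmx (1%:M + sharp_mx (b x) *m sharp_mx (z x))) = v.
  by rewrite /twist mulmxKV //; exact: in_I_b.
have E u1 u2 u3 : dext (fun y => Fmap (z y) (b y)) x
    [:: twist x b z u1; twist x b z u2; twist x b z u3] =
    lam1 b x [:: u1; u2; u3] + 2^-1 * lam2 z 2 b b x [:: u1; u2; u3]
    + 6^-1 * lam3 z 2 b b b x [:: u1; u2; u3].
  by rewrite (dext_Fmap_twist (U := U)) // (maurer_cartan_twist (U := U)).
split=> H s; have [s3|s3] := eqVneq (size s) 3; try exact: hd.
- case: s s3 => [|v1 [|v2 [|v3 [|? ?]]]] //= _.
  by rewrite -(twistK v1) -(twistK v2) -(twistK v3) E.
- by case: s s3 => [|v1 [|v2 [|v3 [|? ?]]]] //= _; rewrite -E.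
- exact: (homogeneous_maurer_cartan Ux).
Qed.

Lemma dextD (w1 w2 : localfield R n) x s : U x ->
  (forall t, smooth_on U (fun y => w1 y t)) ->
  (forall t, smooth_on U (fun y => w2 y t)) ->
  dext (fun y t => w1 y t + w2 y t) x s = dext w1 x s + dext w2 x s.
Proof.
move=> Ux s1 s2; rewrite /dext -big_split; apply: eq_bigr => i _ /=.
by rewrite -mulrDr -deriveD //; apply: smooth_on_derivable Ux.
Qed.

End LocalEquivalence.

(** Applied to forms with the Jacobian of a change of charts, and to bivectors with its
    transpose. *)
Lemma sharp_mx_comp (R : realType) (n : nat) (th th' : multilin R n) (J : 'M[R]_n) :
  alternating 2 th' -> (forall s, th s = th' [seq v *m J | v <- s]) ->
  sharp_mx th = J *m sharp_mx th' *m J^T.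
Proof.
move=> ath' thE; apply/matrixP => i j; rewrite mxE thE /= (alternating2_mx _ _ ath').
by rewrite trmx_mul !mulmxA /evec trmx_delta -colE -!mulmxA -rowE [LHS]mxE [LHS]mxE.
Qed.

(** P = 1 + EZ fixes the vectors of K = ker E, and PE = 0 puts its rows in K. Hence P B P^T is the
    matrix of the form restricted to K along this projection. *)
Lemma horizontal_mx (R : realType) (n : nat) (be : multilin R n) (E Z : 'M[R]_n) :
  E^T = - E -> Z^T = - Z -> E *m Z *m E = - E -> alternating 2 be ->
  (forall s, (forall v, v \in s -> (v <= kermx E)%MS) -> be s = 0) <->
  (1%:M + E *m Z) *m sharp_mx be *m (1%:M + Z *m E) = 0.
Proof.
move=> sE sZ EZE abe.
have PT : (1%:M + E *m Z)^T = 1%:M + Z *m E by exact: mul_N_tr.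
have kerP (v : 'rV[R]_n) : (v <= kermx E)%MS -> v *m (1%:M + E *m Z) = v.
  by move/sub_kermxP => vE; rewrite mulmxDr mulmx1 mulmxA vE mul0mx addr0.
split=> [hor|PBP s hs].
  apply/matrixP => i j.
  have Pker k : (row k (1%:M + E *m Z) <= kermx E)%MS.
    by apply/sub_kermxP; rewrite -row_mul mulmxDl mul1mx EZE subrr row0.
  have := hor [:: row i (1%:M + E *m Z); row j (1%:M + E *m Z)].
  rewrite (alternating2_mx _ _ abe) tr_row PT -row_mul colE !mulmxA -row_mul.
  rewrite -colE !mxE => ->// v.
  by rewrite !inE => /orP[] /eqP ->.
have [s2|s2] := eqVneq (size s) 2; last by have [] := abe; move=> ->.
case: s s2 hs => [|u [|v [|? ?]]] //= _ hs.
have uP : u *m (1%:M + E *m Z) = u by apply/kerP/hs; rewrite inE eqxx.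
have vP : v *m (1%:M + E *m Z) = v by apply/kerP/hs; rewrite !inE eqxx orbT.
rewrite (alternating2_mx _ _ abe) -[in u *m _]uP -[in v^T]vP trmx_mul PT !mulmxA.
by rewrite -2!(mulmxA u) PBP mulmx0 mul0mx mxE.
Qed.

Theorem theorem3p19 (R : realType) (n r : nat) (M : manifold R n)
    (eta : tensor_field M) (heta : presymplectic r eta)
    (G : tangent_distribution M) (hG : subbundle G)
    (hKG : complementary (ker_sharp eta) G)
    (Z : tensor_field M) (hZG : section_wedge2 G Z)
    (hZ : minus_inverse_on G eta Z)
    (be : tensor_field M) (hbe : diff_form 2 be) (hI : section_I Z be) :
  maurer_cartan (ker_sharp eta) Z be <-> presymplectic r (exp_eta eta Z be).
Proof.
have [[[alt_eta smooth_eta] tr_eta] closed_eta rank_eta] := heta.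
have [[[alt_Z smooth_Z] tr_Z] ann_Z] := hZG.
have [[alt_be smooth_be] tr_be] := hbe.
have oU (a : chart_index M) : open (chart_img a) by exact: chart_img_open.
have sharp_exp a x : sharp_mx (exp_eta eta Z be a x) = sharp_mx (eta a x)
    + invmx (1%:M + sharp_mx (be a x) *m sharp_mx (Z a x)) *m sharp_mx (be a x).
  rewrite -[X in _ + X]form_of_mxK; apply/matrixP => i j.
  by rewrite [LHS]mxE [RHS]mxE; congr (_ + _); rewrite mxE.
have inv_Z a x : chart_img a x ->
    let E := sharp_mx (eta a x) in let ZZ := sharp_mx (Z a x) in
    E *m ZZ *m E = - E /\ ZZ *m E *m ZZ = - ZZ.
  move=> ax /=; apply: (@complement_inverse _ _ _ (kermx (sharp_mx (eta a x))) _ (G a x)).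
  - exact: mulmx_ker.
  - exact/sharp_mx_tr/alt_eta.
  - exact/sharp_mx_tr/alt_Z.
  - by have [] := hKG a x ax.
  - exact: ann_Z.
  - exact: hZ.
have hor_rank a x : chart_img a x ->
    (forall s, (forall v, v \in s -> (v <= ker_sharp eta a x)%MS) -> be a x s = 0) <->
    \rank (sharp_mx (exp_eta eta Z be a x)) = r.
  move=> ax; have [EZE ZEZ] := inv_Z a x ax.
  have sE := sharp_mx_tr (alt_eta a x ax); have sZ := sharp_mx_tr (alt_Z a x ax).
  rewrite /ker_sharp (horizontal_mx sE sZ EZE (alt_be a x ax)) sharp_exp.
  by rewrite -(rank_exp EZE ZEZ (hI a x ax)) rank_eta.
have smooth_F a s : smooth_on (chart_img a) (fun y => Fmap (Z a y) (be a y) s).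
  exact: (Fmap_smooth (oU a) (smooth_be a) (smooth_Z a) (hI a) s).
have mc_closed a x : chart_img a x ->
    (forall s, lam1 (be a) x s + 2^-1 * lam2 (Z a) 2 (be a) (be a) x s
       + 6^-1 * lam3 (Z a) 2 (be a) (be a) (be a) x s = 0) <->
    (forall s, dext (exp_eta eta Z be a) x s = 0).
  move=> ax; rewrite (maurer_cartan_iff_closed (oU a) (alt_be a) (smooth_be a)
    (alt_Z a) (smooth_Z a) (hI a) ax).
  (* As eta is closed, only F contributes to the differential. *)
  have dE s : dext (exp_eta eta Z be a) x s = dext (fun y => Fmap (Z a y) (be a y)) x s.
    by rewrite (dextD s ax (smooth_eta a) (smooth_F a)) closed_eta // add0r.
  by split=> H s; have := H s; rewrite dE.
have form_exp : diff_form 2 (exp_eta eta Z be).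
  split; first split=> [a x ax|a s].
  - apply: alternatingD; first exact: alt_eta.
    exact: (Fmap_alternating (alt_be a) (alt_Z a) (hI a) ax).
  - exact: (smooth_onD (oU a) (smooth_eta a s) (smooth_F a s)).
  move=> a c x acx s; rewrite /exp_eta (tr_eta a c x acx s); congr (_ + _).
  have [ax cx] : chart_img a x /\ chart_img c (transition a c x).
    case: acx => p [ap cp] <-; split; first by exists p.
    by rewrite /transition chartK //; exists p.
  case: s => [|u [|v [|? ?]]] //=; rewrite trmx_mul.
  (* The transformation laws of beta and Z in matrix form are the two congruences that [F_congr]
     takes. *)
  have -> : invmx (1%:M + sharp_mx (be a x) *m sharp_mx (Z a x)) *m sharp_mx (be a x) = _ :=
    F_congr (sharp_mx_comp (alt_be c _ cx) (tr_be a c x acx))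
      (etrans (sharp_mx_comp (alt_Z a x ax) (tr_Z a c x acx)) (congr1 _ (trmxK _)))
      (hI a x ax) (hI c _ cx).
  by rewrite !mulmxA.
(* The conditions correspond separately, at each point of each chart: the bracket equation to
   closedness, horizontality to the rank. *)
split=> [[_ hor mc]|[_ closed rk]]; split=> //.
- by move=> a x ax; apply/mc_closed => // s; exact: mc.
- by move=> a x ax; apply/hor_rank => // s; exact: hor.
- by move=> a x ax; apply/hor_rank => //; exact: rk.
- by move=> a x ax; apply/mc_closed => // s; exact: closed.
Qed.
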